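(* Let $B$ be a real $N\times N$ matrix such that $\sup_{t\in\mathbb{R}}\|\exp(-tB)\|<\infty$, and let $\mathscr{L}=\Delta+\langle Bx,\nabla\rangle-\partial_t$ on $\mathbb{R}^{N+1}=\mathbb{R}^N_x\times\mathbb{R}_t$. Let $u:\mathbb{R}^{N+1}\to\mathbb{R}$ be a smooth solution to $\mathscr{L}u=0$ in $\mathbb{R}^{N+1}$. If $\inf_{\mathbb{R}^{N+1}}u>-\infty$, then $$\lim_{t\to-\infty}u(x,t)=\inf_{\mathbb{R}^{N+1}}u\qquad\text{for every }x\in\mathbb{R}^N.$$
   Context: $\Delta$, $\nabla$ and $\langle\cdot,\cdot\rangle$ are the Laplace operator, the gradient and the inner product in $\mathbb{R}^N$ (acting in the variable $x$), so $\mathscr{L}u(x,t)=\Delta_x u(x,t)+\langle Bx,\nabla_x u(x,t)\rangle-\partial_t u(x,t)$. $\|\cdot\|$ is the operator norm. Smooth means $C^\infty$. *)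

(* Defs.v *)
From mathcomp Require Import all_boot all_order all_algebra.
From mathcomp Require Import all_classical all_reals all_analysis.

Set Implicit Arguments.
Unset Strict Implicit.
Unset Printing Implicit Defensive.

Import Order.TTheory GRing.Theory Num.Theory.
Import numFieldNormedType.Exports.

Local Open Scope classical_set_scope.
Local Open Scope ring_scope.

(* The library norm on matrices and column vectors is the entrywise maximum;
   it induces the usual topology, but the Euclidean norm of R^N has to be
   defined separately. *)
Definition dotp (R : realType) (N : nat) (x y : 'cV[R]_N) : R :=
  \sum_(i < N) x i 0 * y i 0.

Definition enorm (R : realType) (N : nat) (x : 'cV[R]_N) : R :=
  Num.sqrt (dotp x x).

(* Operator norm subordinate to the Euclidean norm; the set is nonempty and
   bounded, so that [sup] never takes its default value. *)
Definition opnorm (R : realType) (N : nat) (A : 'M[R]_N) : R :=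
  sup [set enorm (A *m x) | x in [set x : 'cV[R]_N | enorm x <= 1]].

Definition expmx (R : realType) (N : nat) (A : 'M[R]_N) : 'M[R]_N :=
  limn (series (fun k : nat => (k`!%:R)^-1 *: A ^+ k)).

Fixpoint Ck (R : realType) (V : normedModType R) (k : nat) (f : V -> R) : Prop :=
  if k is k'.+1 then
    (forall z : V, differentiable f z) /\ (forall v : V, Ck k' (fun z => 'D_v f z))
  else continuous f.

Definition smooth (R : realType) (V : normedModType R) (f : V -> R) : Prop :=
  forall k : nat, Ck k f.

Definition pderiv (R : realType) (N : nat) (i : 'I_N) (f : 'cV[R]_N -> R) :
    'cV[R]_N -> R :=
  fun x => 'D_(delta_mx i 0) f x.

Definition grad (R : realType) (N : nat) (f : 'cV[R]_N -> R) (x : 'cV[R]_N) :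
    'cV[R]_N :=
  \col_(i < N) pderiv i f x.

Definition laplacian (R : realType) (N : nat) (f : 'cV[R]_N -> R)
    (x : 'cV[R]_N) : R :=
  \sum_(i < N) pderiv i (pderiv i f) x.

Definition Lop (R : realType) (N : nat) (B : 'M[R]_N) (u : 'cV[R]_N * R -> R)
    (z : 'cV[R]_N * R) : R :=
  laplacian (fun y => u (y, z.2)) z.1
  + dotp (B *m z.1) (grad (fun y => u (y, z.2)) z.1)
  - derive1 (fun s : R => u (z.1, s)) z.2.

(* Main.v *)
Require Import Defs.
From mathcomp Require Import all_boot all_order all_algebra.
From mathcomp Require Import all_classical all_reals all_analysis.
From mathcomp Require Import ring lra zify.

Set Implicit Arguments.
Unset Strict Implicit.
Unset Printing Implicit Defensive.

Import Order.TTheory GRing.Theory Num.Theory.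
Import numFieldNormedType.Exports.

Local Open Scope classical_set_scope.
Local Open Scope ring_scope.

(** Subtract the infimum, so that u >= 0 has infimum 0. In the coordinates moving
    with the drift, w(y, t) = u(exp(-tB) y, t) satisfies w_t = tr (A(t) D^2 w) with
    A(t) = exp(tB) exp(tB)^T ([solution_of_Lop]). Since exp(tB) is bounded for t of
    both signs, A(t) is uniformly elliptic ([elliptic_expmx]), and nonnegative
    solutions on the whole space-time obey a Harnack inequality ([harnack]): there
    are constants C and kappa with w(x, t) <= C w(x0, t0) as soon as
    t0 - t >= kappa |x0 - x|^2. Choose (x0, t0) where w is small. As t goes to -oo
    the points exp(tB) x remain in a ball, so the inequality applies to all of them
    for t negative enough, and u(x, t) = w(exp(tB) x, t) is small.

    The Harnack inequality rests on the maximum principle alone; neither a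
    fundamental solution nor an integral appears. Three facts carry it.
    - [solution_lipschitz]: a bounded solution has a Lipschitz bound in space at the
      scale of the cylinder on which it is bounded. This comes from doubling the
      space variable and coupling the two copies by reflection.
    - [positivity_spreads]: a lower bound on a small ball propagates to later times
      inside a paraboloid, with a polynomial loss. This comes from comparison with
      an explicit compactly supported subsolution.
    - [point_picking]: a solution large at one point is, near a suitable point, at
      most a constant times its value there, so that the first fact turns largeness
      at a point into largeness on a ball.
    The weight in the third fact is chosen to match the loss in the second. *)

(** * Euclidean geometry of column vectors *)

Lemma dotpC (R : realType) N (x y : 'cV[R]_N) : dotp x y = dotp y x.
Proof. by rewrite /dotp; apply: eq_bigr => i _; rewrite mulrC. Qed.

Lemma dotpDl (R : realType) N (x y z : 'cV[R]_N) :
  dotp (x + y) z = dotp x z + dotp y z.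
Proof.
by rewrite /dotp -big_split; apply: eq_bigr => i _; rewrite mxE mulrDl.
Qed.

Lemma dotpZl (R : realType) N (a : R) (x y : 'cV[R]_N) :
  dotp (a *: x) y = a * dotp x y.
Proof.
by rewrite /dotp mulr_sumr; apply: eq_bigr => i _; rewrite mxE mulrA.
Qed.

Lemma dotpDr (R : realType) N (x y z : 'cV[R]_N) :
  dotp x (y + z) = dotp x y + dotp x z.
Proof. by rewrite dotpC dotpDl !(dotpC _ x). Qed.

Lemma dotpZr (R : realType) N (a : R) (x y : 'cV[R]_N) :
  dotp x (a *: y) = a * dotp x y.
Proof. by rewrite dotpC dotpZl dotpC. Qed.

Lemma dotpNl (R : realType) N (x y : 'cV[R]_N) : dotp (- x) y = - dotp x y.
Proof. by rewrite -scaleN1r dotpZl mulN1r. Qed.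

Lemma dotpNr (R : realType) N (x y : 'cV[R]_N) : dotp x (- y) = - dotp x y.
Proof. by rewrite dotpC dotpNl dotpC. Qed.

Lemma dotp_delta (R : realType) N (x : 'cV[R]_N) i :
  dotp x (delta_mx i 0) = x i 0.
Proof.
rewrite /dotp (bigD1 i) //= mxE !eqxx mulr1 big1 ?addr0 // => j ji.
by rewrite mxE (negbTE ji) mulr0.
Qed.

Lemma dotp_mulmx (R : realType) N (A : 'M[R]_N) (x y : 'cV[R]_N) :
  dotp (A *m x) y = dotp x (A^T *m y).
Proof.
rewrite /dotp.
under eq_bigr do rewrite mxE mulr_suml.
under [RHS]eq_bigr do rewrite mxE mulr_sumr.
rewrite exchange_big /=; apply: eq_bigr => i _; apply: eq_bigr => j _.
by rewrite mxE mulrAC mulrC.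
Qed.

Definition nsq (R : realType) N (x : 'cV[R]_N) : R := dotp x x.

Lemma nsq_ge0 (R : realType) N (x : 'cV[R]_N) : 0 <= nsq x.
Proof. by apply: sumr_ge0 => i _; rewrite -expr2 sqr_ge0. Qed.

Lemma nsq0 (R : realType) N : nsq (0 : 'cV[R]_N) = 0.
Proof. by apply: big1 => i _; rewrite mxE mul0r. Qed.

Lemma nsq_eq0 (R : realType) N (x : 'cV[R]_N) : nsq x = 0 -> x = 0.
Proof.
move=> /psumr_eq0P h; apply/colP => i; rewrite mxE.
have /h/(_ i isT)/eqP : forall j, true -> 0 <= x j 0 * x j 0.
  by move=> j _; rewrite -expr2 sqr_ge0.
by rewrite mulf_eq0 orbb => /eqP.
Qed.

Lemma nsqZ (R : realType) N (a : R) (x : 'cV[R]_N) :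
  nsq (a *: x) = a ^+ 2 * nsq x.
Proof. by rewrite /nsq dotpZl dotpZr mulrA expr2. Qed.

Lemma nsqN (R : realType) N (x : 'cV[R]_N) : nsq (- x) = nsq x.
Proof. by rewrite /nsq dotpNl dotpNr opprK. Qed.

Lemma nsqD (R : realType) N (x y : 'cV[R]_N) :
  nsq (x + y) = nsq x + 2 * dotp x y + nsq y.
Proof. by rewrite /nsq dotpDl !dotpDr (dotpC y x); ring. Qed.

Lemma nsq_line (R : realType) N (x a : 'cV[R]_N) (s : R) :
  nsq (x + s *: a) = nsq x + 2 * dotp x a * s + nsq a * s ^+ 2.
Proof. by rewrite nsqD dotpZr nsqZ; ring. Qed.

Lemma cauchy_schwarz (R : realType) N (x y : 'cV[R]_N) :
  dotp x y ^+ 2 <= nsq x * nsq y.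
Proof.
have [y0|y0] := eqVneq (nsq y) 0.
  by rewrite (nsq_eq0 y0) -(scale0r (0 : 'cV[R]_N)) dotpZr mul0r expr0n /=
    mulr_ge0 ?nsq_ge0.
have yp : 0 < nsq y by rewrite lt_neqAle eq_sym y0 nsq_ge0.
have := nsq_ge0 (nsq y *: x - dotp x y *: y).
rewrite nsqD nsqN !nsqZ dotpNr dotpZl dotpZr => h.
rewrite -subr_ge0 -(pmulr_rge0 _ yp); apply: le_trans h _.
by rewrite le_eqVlt; apply/orP; left; apply/eqP; ring.
Qed.

Lemma nsqD_le (R : realType) N (x y : 'cV[R]_N) :
  nsq (x + y) <= 2 * nsq x + 2 * nsq y.
Proof.
have := nsq_ge0 (x - y); rewrite !nsqD nsqN dotpNr; lra.
Qed.

Lemma enorm_ge0 (R : realType) N (x : 'cV[R]_N) : 0 <= enorm x.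
Proof. exact: sqrtr_ge0. Qed.

Lemma enorm_sqr (R : realType) N (x : 'cV[R]_N) : enorm x ^+ 2 = nsq x.
Proof. by rewrite sqr_sqrtr // nsq_ge0. Qed.

Lemma enorm_le (R : realType) N (x : 'cV[R]_N) (r : R) : 0 <= r ->
  (enorm x <= r) = (nsq x <= r ^+ 2).
Proof. by move=> r0; rewrite -enorm_sqr ler_pXn2r ?nnegrE ?enorm_ge0. Qed.

Lemma enormD (R : realType) N (x y : 'cV[R]_N) :
  enorm (x + y) <= enorm x + enorm y.
Proof.
rewrite enorm_le ?addr_ge0 ?enorm_ge0 // nsqD.
have : dotp x y <= enorm x * enorm y.
  apply: le_trans (ler_norm _) _.
  rewrite -(ler_pXn2r (ltn0Sn 1)) ?nnegrE ?mulr_ge0 ?enorm_ge0 ?normr_ge0 //.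
  by rewrite real_normK ?num_real // exprMn !enorm_sqr cauchy_schwarz.
rewrite -!enorm_sqr; nra.
Qed.

Lemma enormZ (R : realType) N (a : R) (x : 'cV[R]_N) :
  enorm (a *: x) = `|a| * enorm x.
Proof.
by rewrite /enorm -/(nsq _) nsqZ sqrtrM ?sqr_ge0 // sqrtr_sqr.
Qed.

Lemma nsq_delta (R : realType) N (i : 'I_N) :
  nsq (delta_mx i 0 : 'cV[R]_N) = 1.
Proof. by rewrite /nsq dotp_delta mxE !eqxx. Qed.

(** The i-th basis vector reflected in the hyperplane orthogonal to n, when n is a
    unit vector; n = 0 gives back the basis itself, so that one formula covers
    both frames used below. *)
Definition refl (R : realType) N (n : 'cV[R]_N) (i : 'I_N) : 'cV[R]_N :=
  delta_mx i 0 - (2 * n i 0) *: n.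

Lemma refl0 (R : realType) N i : refl (0 : 'cV[R]_N) i = delta_mx i 0.
Proof. by rewrite /refl scaler0 subr0. Qed.

Lemma nsq_refl (R : realType) N (n : 'cV[R]_N) i : nsq n = 1 ->
  nsq (refl n i) = 1.
Proof.
move=> n1; rewrite /refl nsqD nsqN nsqZ n1 nsq_delta dotpNr dotpZr dotpC.
by rewrite dotp_delta; ring.
Qed.

(** The trace of a bilinear form is the same in every orthonormal basis. Symmetry
    is not assumed, so that it applies to a Hessian before its symmetry is known. *)
Lemma sum_bilinear_refl (R : realType) N (h : 'cV[R]_N -> 'cV[R]_N -> R)
    (hl : forall a x x' y, h (x + a *: x') y = h x y + a * h x' y)
    (hr : forall a x y y', h x (y + a *: y') = h x y + a * h x y')
    (n : 'cV[R]_N) : n = 0 \/ nsq n = 1 ->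
  \sum_(i < N) h (refl n i) (refl n i) =
  \sum_(i < N) h (delta_mx i 0) (delta_mx i 0).
Proof.
have h0l y : h 0 y = 0.
  by have := hl 1 0 0 y; rewrite scaler0 addr0 mul1r; lra.
have h0r y : h y 0 = 0.
  by have := hr 1 y 0 0; rewrite scaler0 addr0 mul1r; lra.
case=> [->|n1]; first by apply: eq_bigr => i _; rewrite refl0.
have nE : n = \sum_(i < N) n i 0 *: delta_mx i 0.
  by rewrite [LHS]matrix_sum_delta; apply: eq_bigr => i _; rewrite big_ord1.
have El y : \sum_(i < N) n i 0 * h (delta_mx i 0) y = h n y.
  rewrite {2}nE; elim/big_rec2 : _ => [|i a b _ ->]; first by rewrite h0l.
  by rewrite addrC [in RHS]addrC hl.
have Er y : \sum_(i < N) n i 0 * h y (delta_mx i 0) = h y n.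
  rewrite {2}nE; elim/big_rec2 : _ => [|i a b _ ->]; first by rewrite h0r.
  by rewrite addrC [in RHS]addrC hr.
transitivity (\sum_(i < N) (h (delta_mx i 0) (delta_mx i 0)
    + ((- 2) * (n i 0 * h (delta_mx i 0) n)
    + ((- 2) * (n i 0 * h n (delta_mx i 0))
    + 4 * h n n * (n i 0 * n i 0))))).
  by apply: eq_bigr => i _; rewrite /refl -scaleNr hl !hr; ring.
rewrite !big_split /= -!mulr_sumr El Er -/(dotp n n) -/(nsq n) n1.
by ring.
Qed.

(** * Derivative tests on the line *)

Lemma is_derive_gt0_near (R : realType) (f : R -> R) (x d : R) :
  is_derive x (1 : R) f d -> 0 < d ->
  exists2 e : R, 0 < e & forall h, 0 < h -> h < e ->
    f x < f (x + h) /\ f (x - h) < f x.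
Proof.
move=> [/[dup] df /cvg_ex [/= l fl] fd] d0.
have ld : l = d by rewrite -fd; apply/esym/cvg_lim.
move: fl; rewrite ld => /cvgrPdist_lt /(_ _ d0) /= [e /= e0 he].
exists e => // h h0 hle.
have pos k : k != 0 -> `|k| < e -> 0 < k^-1 * (f (k + x) - f x).
  move=> k0 ke; have := he k; rewrite /= sub0r normrN => /(_ ke k0).
  rewrite [_%:A]mulr1 => /(le_lt_trans (ler_norm _)).
  by rewrite /GRing.scale /=; lra.
split.
  have := pos h (lt0r_neq0 h0); rewrite gtr0_norm // => /(_ hle).
  by rewrite pmulr_rgt0 ?invr_gt0 // subr_gt0 addrC.
have := pos (- h); rewrite oppr_eq0 normrN gtr0_norm // lt0r_neq0 //.
move=> /(_ isT hle); rewrite invrN mulNr oppr_gt0 pmulr_rlt0 ?invr_gt0 //.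
by rewrite subr_lt0 addrC.
Qed.

(** The maximum may sit on the final time slice, where only earlier times are
    available: one-sided information still gives the sign of the derivative. *)
Lemma is_derive_left_max (R : realType) (f : R -> R) (x d e : R) :
  is_derive x (1 : R) f d -> 0 < e ->
  (forall s, x - e < s -> s <= x -> f s <= f x) -> 0 <= d.
Proof.
move=> fd e0 fmax; rewrite leNgt; apply/negP => d0.
have [|e' e'0 he] := @is_derive_gt0_near _ (- f) x (- d) _; first by lra.
pose h := Num.min e e' / 2.
have hm : 0 < Num.min e e' by rewrite lt_min e0 e'0.
have h0 : 0 < h by rewrite divr_gt0.
have [he1 he2] : h < e /\ h < e'.
  by apply/andP; rewrite -lt_min /h; lra.
have [_] := he h h0 he2; rewrite /= !fctE ltrN2.
by rewrite ltNge fmax //; lra.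
Qed.

(** Twice differentiability at 0 as the second-derivative test needs it: a
    derivative on the whole line, itself differentiable at 0. *)
Definition has_d2 (R : realType) (f : R -> R) (l : R) :=
  exists2 f' : R -> R,
    (forall s, is_derive s (1 : R) f (f' s)) & is_derive (0 : R) (1 : R) f' l.

Lemma has_d2_ext (R : realType) (f g : R -> R) (l m : R) :
  f =1 g -> l = m -> has_d2 f l -> has_d2 g m.
Proof. by move=> /funext -> ->. Qed.

Lemma has_d2D (R : realType) (f g : R -> R) (l m : R) :
  has_d2 f l -> has_d2 g m -> has_d2 (fun s => f s + g s) (l + m).
Proof.
move=> [f' df f'0] [g' dg g'0]; exists (fun s => f' s + g' s) => //.
  by move=> s; have := df s; have := dg s => *; apply: is_deriveD.
exact: is_deriveD.
Qed.

Lemma has_d2Z (R : realType) (f : R -> R) (l c : R) :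
  has_d2 f l -> has_d2 (fun s => c * f s) (c * l).
Proof.
move=> [f' df f'0]; exists (fun s => c * f' s) => //.
  by move=> s; have := df s => *; apply: is_deriveZ.
exact: is_deriveZ.
Qed.

Lemma is_derive_ext (R : realType) (f g : R -> R) (x d d' : R) :
  f =1 g -> d = d' -> is_derive x (1 : R) f d -> is_derive x (1 : R) g d'.
Proof. by move=> /funext -> ->. Qed.

Lemma is_derive_quadratic (R : realType) (a b c s : R) :
  is_derive s (1 : R) (fun s => a + b * s + c * s ^+ 2) (b + 2 * c * s).
Proof.
have h1 := is_deriveZ b (is_derive_id s (1 : R)).
have h2 := is_deriveZ c (is_deriveM (is_derive_id s 1) (is_derive_id s 1)).
have h := is_deriveD (is_deriveD (is_derive_cst a s 1) h1) h2.
apply: is_derive_ext h => [x|]; first by rewrite expr2.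
by rewrite /GRing.scale /=; ring.
Qed.

Lemma is_derive_affine (R : realType) (a b s : R) :
  is_derive s (1 : R) (fun s => a + b * s) b.
Proof.
apply: is_derive_ext (is_derive_quadratic a b 0 s) => [x|]; by ring.
Qed.

Lemma has_d2_quadratic (R : realType) (a b c : R) :
  has_d2 (fun s => a + b * s + c * s ^+ 2) (2 * c).
Proof.
exists (fun s => b + 2 * c * s); first exact: is_derive_quadratic.
exact: is_derive_affine.
Qed.

Lemma has_d2_quadratic_sqr (R : realType) (a b c : R) :
  has_d2 (fun s => (a + b * s + c * s ^+ 2) ^+ 2) (2 * b ^+ 2 + 4 * a * c).
Proof.
pose q := fun s : R => a + b * s + c * s ^+ 2.
have dq s := is_derive_quadratic a b c s.
have dl := is_derive_affine b (2 * c) 0.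
exists (fun s => 2 * (q s * (b + 2 * c * s))).
  move=> s; apply: is_derive_ext (is_deriveM (dq s) (dq s)) => [x|].
    by rewrite expr2.
  by rewrite /GRing.scale /= /q; ring.
apply: is_derive_ext (is_deriveZ 2 (is_deriveM (dq 0) dl)) => [x|] //.
by rewrite /GRing.scale /=; ring.
Qed.

(** If f'' were positive, f' would be positive just to the right of 0, and the mean
    value theorem would give values above f 0. *)
Lemma has_d2_max (R : realType) (f : R -> R) (l : R) : has_d2 f l ->
  (\forall s \near (0 : R), f s <= f 0) -> l <= 0.
Proof.
move=> [f' df f'0] /nbhs_ballP [e /= e0 he].
have fmax s : `|s| < e -> f s <= f 0.
  by move=> se; apply: he; rewrite /ball /= sub0r normrN.
have d0 : f' 0 = 0.
  have [_ d0] : is_derive (0 : R) (1 : R) f 0.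
    apply: (@derive1_at_max _ f (- e) e); first by lra.
    - by move=> t _; have [] := df t.
    - by rewrite in_itv /=; lra.
    - by move=> t; rewrite in_itv /= => te; apply: fmax; rewrite ltr_norml.
  by have [_ <-] := df 0.
rewrite leNgt; apply/negP => l0.
have [e' e'0 he'] := is_derive_gt0_near f'0 l0.
pose h := Num.min e e' / 2.
have hm : 0 < Num.min e e' by rewrite lt_min e0 e'0.
have h0 : 0 < h by rewrite divr_gt0.
have [he1 he2] : h < e /\ h < e'.
  by apply/andP; rewrite -lt_min /h; lra.
have [//||c] := @MVT _ f f' 0 h.
  apply: derivable_within_continuous => t _; by have [] := df t.
rewrite in_itv /= subr0 => /andP [c0 ch] E.
have : f h <= f 0 by apply: fmax; rewrite gtr0_norm.
have [] := he' c c0 (lt_trans ch he2); rewrite add0r d0 => fc _.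
have := mulr_gt0 fc h0; lra.
Qed.

(** * Continuity, compactness, and the parabolic equation *)

Lemma continuous_coord (R : realType) (T : topologicalType) m n
    (f : T -> 'M[R]_(m, n)) i j :
  continuous f -> continuous (fun x => f x i j).
Proof.
move=> cf x; apply: (@continuous_comp _ _ _ f (fun M => M i j)).
  exact: cf.
exact: coord_continuous.
Qed.

Lemma contD (R : realType) (T : topologicalType) (V : normedModType R)
    (f g : T -> V) :
  continuous f -> continuous g -> continuous (fun x => f x + g x).
Proof. by move=> cf cg x; apply: cvgD; [exact: cf|exact: cg]. Qed.

Lemma contB (R : realType) (T : topologicalType) (V : normedModType R)
    (f g : T -> V) :
  continuous f -> continuous g -> continuous (fun x => f x - g x).
Proof. by move=> cf cg x; apply: cvgB; [exact: cf|exact: cg]. Qed.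

Lemma contZ (R : realType) (T : topologicalType) (V : normedModType R)
    (f : T -> R) (g : T -> V) :
  continuous f -> continuous g -> continuous (fun x => f x *: g x).
Proof. by move=> cf cg x; apply: cvgZ; [exact: cf|exact: cg]. Qed.

Lemma contM (R : realType) (T : topologicalType) (f g : T -> R) :
  continuous f -> continuous g -> continuous (fun x => f x * g x).
Proof. by move=> cf cg x; apply: cvgM; [exact: cf|exact: cg]. Qed.

Lemma cont_cst (T U : topologicalType) (c : U) : continuous (fun _ : T => c).
Proof. by move=> x; exact: cvg_cst. Qed.

Lemma cont_id (T : topologicalType) : continuous (fun x : T => x).
Proof. by move=> x; exact: cvg_id. Qed.

Lemma cont_fst (T U V : topologicalType) (f : T -> U * V) :
  continuous f -> continuous (fun x => (f x).1).
Proof.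
move=> cf x; apply: (@continuous_comp _ _ _ f fst); first exact: cf.
exact: cvg_fst.
Qed.

Lemma cont_snd (T U V : topologicalType) (f : T -> U * V) :
  continuous f -> continuous (fun x => (f x).2).
Proof.
move=> cf x; apply: (@continuous_comp _ _ _ f snd); first exact: cf.
exact: cvg_snd.
Qed.

Lemma cont_pair (T U V : topologicalType) (f : T -> U) (g : T -> V) :
  continuous f -> continuous g -> continuous (fun x => (f x, g x)).
Proof. by move=> cf cg x; apply: cvg_pair; [exact: cf|exact: cg]. Qed.

Lemma cvg_mx (R : realType) (T : Type) (F : set_system T) m n
    (f : T -> 'M[R]_(m, n)) (l : 'M[R]_(m, n)) : Filter F ->
  (forall i j, f x i j @[x --> F] --> l i j) -> f @ F --> l.
Proof.
move=> FF cf; apply/cvgrPdist_le => /= e e0.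
near=> y; rewrite /Num.Def.normr /= mx_normrE (bigmax_le _ (ltW e0)) //= => i _.
rewrite !mxE; move: i; near: y; apply: filter_forall => i.
by have /cvgrPdist_le := cf i.1 i.2; apply.
Unshelve. all: by end_near. Qed.

Lemma continuous_mx (R : realType) (T : topologicalType) m n
    (f : T -> 'M[R]_(m, n)) :
  (forall i j, continuous (fun x => f x i j)) -> continuous f.
Proof. by move=> cf x; apply: cvg_mx => i j; exact: cf. Qed.

Lemma cont_sum (R : realType) (T : topologicalType) N (f : 'I_N -> T -> R) :
  (forall i, continuous (f i)) -> continuous (fun x => \sum_(i < N) f i x).
Proof.
move=> cf x; apply: cvg_big => [|i _]; first exact: add_continuous.
exact: cf.
Qed.

Lemma continuous_dotp (R : realType) (T : topologicalType) N
    (f g : T -> 'cV[R]_N) :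
  continuous f -> continuous g -> continuous (fun x => dotp (f x) (g x)).
Proof.
by move=> cf cg; apply: cont_sum => i; apply: contM; exact: continuous_coord.
Qed.

Lemma continuous_mulmx (R : realType) (T : topologicalType) m n p
    (f : T -> 'M[R]_(m, n)) (g : T -> 'M[R]_(n, p)) :
  continuous f -> continuous g -> continuous (fun x => f x *m g x).
Proof.
move=> cf cg; apply: continuous_mx => i j.
rewrite (_ : (fun x => (f x *m g x) i j) =
  (fun x => \sum_k f x i k * g x k j)); last by apply/funext => x; rewrite mxE.
by apply: cont_sum => k; apply: contM; exact: continuous_coord.
Qed.

Lemma continuous_enorm (R : realType) (T : topologicalType) N
    (f : T -> 'cV[R]_N) :
  continuous f -> continuous (fun x => enorm (f x)).
Proof.
move=> cf x; apply: (@continuous_comp _ _ _ (fun x => dotp (f x) (f x)) Num.sqrt).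
  exact: continuous_dotp.
exact: sqrt_continuous.
Qed.

Lemma closed_le_cont (R : realType) (T : topologicalType) (f : T -> R) (r : R) :
  continuous f -> closed [set x | f x <= r].
Proof.
by move=> cf; apply: (@preimage_closed _ _ f [set y | y <= r]) => [x _|];
  [exact: cf|exact: closed_le].
Qed.

(** Closed and contained in a coordinate box; transposition carries over the
    compactness of boxes of row vectors. *)
Lemma compact_ball (R : realType) N (c : 'cV[R]_N) (r : R) :
  compact [set x | nsq (x - c) <= r].
Proof.
pose A (i : 'I_N) := `[c i 0 - (`|r| + 1), c i 0 + (`|r| + 1)]%classic.
have cA : compact [set v : 'rV[R]_N | forall i, A i (v ord0 i)].
  by apply: rV_compact => i; exact: segment_compact.
apply: (@subclosed_compact _ _ (trmx @` [set v : 'rV[R]_N | forall i, A i (v ord0 i)])).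
- have cB : continuous (fun x : 'cV[R]_N => x - c).
    by apply: contB; [exact: cont_id|exact: cont_cst].
  apply: (@closed_le_cont _ _ (fun x : 'cV[R]_N => nsq (x - c))).
  exact: continuous_dotp.
- apply: continuous_compact => //.
  apply: (continuous_subspaceT (f := trmx)); apply: continuous_mx => i j x.
  under eq_fun do rewrite mxE; rewrite ?mxE; exact: coord_continuous.
- move=> x /= hx; exists x^T; last by rewrite trmxK.
  move=> i; rewrite /A /= mxE in_itv /= -ler_distlC.
  suff : `|x i 0 - c i 0| ^+ 2 <= r.
    rewrite distrC; have := ler_norm r; have := normr_ge0 (x i 0 - c i 0); nra.
  rewrite real_normK ?num_real //; apply: le_trans hx.
  rewrite /nsq /dotp (bigD1 i) //= !mxE -expr2 lerDl.
  by apply: sumr_ge0 => j _; rewrite -expr2 sqr_ge0.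
Qed.

(** Uniform ellipticity of S S^T. The bounds are put on S itself because the
    comparison arguments differentiate along the columns of S. *)
Definition elliptic (R : realType) N (L : R) (S : R -> 'M[R]_N) :=
  forall t, (forall x, nsq (S t *m x) <= L * nsq x) /\
    (forall x, exists2 y, S t *m y = x & nsq y <= L * nsq x).

(** The equation w_t = tr (S S^T D^2 w). The right-hand side is the sum of second
    derivatives along the images under S of an orthonormal frame; asking for it in
    every reflected frame records the invariance of the trace, and only pure second
    derivatives along lines have to be mentioned. *)
Definition solution (R : realType) N (S : R -> 'M[R]_N)
    (w : 'cV[R]_N -> R -> R) :=
  continuous (fun z => w z.1 z.2) /\
  forall y t, exists d, exists H : 'cV[R]_N -> R,
    [/\ is_derive t (1 : R) (w y) d,
        forall a, has_d2 (fun s => w (y + s *: a) t) (H a) &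
        forall n : 'cV[R]_N, n = 0 \/ nsq n = 1 ->
          d = \sum_(i < N) H (S t *m refl n i)].

Lemma near_lt_line (R : realType) N (y a : 'cV[R]_N) (r : R) :
  nsq y < r -> \forall s \near (0 : R), nsq (y + s *: a) < r.
Proof.
move=> hy; have : (fun s : R => nsq (y + s *: a)) @ 0 --> nsq y.
  rewrite -[X in _ --> nsq X]addr0 -(scale0r a).
  have cl : continuous (fun s : R => y + s *: a).
    apply: contD; first exact: cont_cst.
    by apply: contZ; [exact: cont_id|exact: cont_cst].
  exact: (@continuous_dotp _ _ _ (fun s : R => y + s *: a)).
by move=> /cvgr_lt; apply.
Qed.

(** * Lipschitz bound by reflection coupling *)

Lemma sum_nsq_le (R : realType) N (L : R) (a : 'I_N -> 'cV[R]_N) :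
  (forall i, nsq (a i) <= L) -> \sum_(i < N) nsq (a i) <= N%:R * L.
Proof.
move=> h; apply: (@le_trans _ _ (\sum_(i < N) L)); first exact: ler_sum.
by rewrite sumr_const card_ord mulr_natl.
Qed.

(** Reflecting the frame in the direction eta = S^-1 xi changes the driving vectors
    S e_i by multiples of xi only: two points moved by the two frames approach or
    separate along the line that joins them. The sum of squares measures how fast. *)
Lemma reflection_step (R : realType) N (S : 'M[R]_N) (xi eta : 'cV[R]_N) :
  S *m eta = xi -> xi != 0 ->
  exists2 n : 'cV[R]_N, nsq n = 1 & exists2 c : 'I_N -> R,
    (forall i, S *m delta_mx i 0 - S *m refl n i = c i *: xi) &
    \sum_(i < N) c i ^+ 2 = 4 / nsq eta.
Proof.
move=> Se xi0.
have eta0 : 0 < nsq eta.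
  rewrite lt_neqAle nsq_ge0 andbT eq_sym; apply: contra xi0 => /eqP/nsq_eq0 e0.
  by rewrite -Se e0 mulmx0.
have en0 : enorm eta != 0 by rewrite sqrtr_eq0 -ltNge.
pose n := (enorm eta)^-1 *: eta.
have n1 : nsq n = 1 by rewrite nsqZ exprVn enorm_sqr mulVf // lt0r_neq0.
exists n => //; exists (fun i => 2 * n i 0 / enorm eta) => [i|].
  rewrite -mulmxBr /refl opprB addrC subrK -scalemxAr -scalemxAr Se scalerA.
  by [].
under eq_bigr do rewrite !exprMn exprVn enorm_sqr mulrAC (expr2 (n _ _)).
rewrite -mulr_sumr -/(dotp n n) -/(nsq n) n1 mulr1.
by congr (_ / _); ring.
Qed.

(** Doubling of variables. The difference w(Y) - w(Z) solves an equation in the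
    pair (Y, Z); with the frame of Z reflected in the direction Y - Z, the distance
    |Y - Z| moves linearly along each line, so the concave part -b |Y - Z|^2 of the
    barrier has a large negative second derivative. It beats the localizing terms,
    and the maximum principle bounds the difference by the barrier. *)
Lemma solution_lipschitz (R : realType) N (L : R) (S : R -> 'M[R]_N)
    (w : 'cV[R]_N -> R -> R) (b := L * (N%:R * L + 1)) :
  0 < L -> elliptic L S -> solution S w ->
  forall (K r : R) y1 s1 y, 0 < K -> 0 < r ->
  (forall y t, nsq (y - y1) <= r ^+ 2 -> s1 - r ^+ 2 <= t -> t <= s1 ->
    0 <= w y t <= K) ->
  nsq (y - y1) <= r ^+ 2 ->
  r ^+ 2 * (w y1 s1 - w y s1) <=
    K * (2 * b * r * enorm (y1 - y) + nsq (y - y1)).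
Proof.
move=> L0 ell [wc wsol] K r y1 s1 y K0 r0 hw hy.
have b0 : 0 < b by rewrite mulr_gt0 // ltr_wpDl // mulr_ge0 // ltW.
rewrite leNgt; apply/negP => hlt.
(* On the lateral and initial boundary the last two terms add up to at least
   r ^+ 2, and K * r ^+ 2 bounds the rescaled difference. *)
pose Psi (Y Z : 'cV[R]_N) t : R := 2 * b * r * enorm (Y - Z) - b * nsq (Y - Z) +
  (nsq (Y - y1) + nsq (Z - y1)) + (s1 - t).
pose f (z : ('cV[R]_N * 'cV[R]_N) * R) :=
  r ^+ 2 * (w z.1.1 z.2 - w z.1.2 z.2) - K * Psi z.1.1 z.1.2 z.2.
pose B := [set x : 'cV[R]_N | nsq (x - y1) <= r ^+ 2].
pose A := (B `*` B) `*` `[s1 - r ^+ 2, s1]%classic.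
have rr0 : 0 < r ^+ 2 by rewrite exprn_gt0.
have cA : compact A.
  apply: compact_setX; last exact: segment_compact.
  by apply: compact_setX; exact: compact_ball.
have cf : continuous f.
  have c1 : continuous (fun z : ('cV[R]_N * 'cV[R]_N) * R => z.1.1).
    by do 2 apply: cont_fst; exact: cont_id.
  have c2 : continuous (fun z : ('cV[R]_N * 'cV[R]_N) * R => z.1.2).
    by apply: cont_snd; apply: cont_fst; exact: cont_id.
  have c3 : continuous (fun z : ('cV[R]_N * 'cV[R]_N) * R => z.2).
    by apply: cont_snd; exact: cont_id.
  have wc' g : continuous g -> continuous
      (fun z : ('cV[R]_N * 'cV[R]_N) * R => w (g z) z.2).
    move=> cg x.
    apply: (@continuous_comp _ _ _ (fun z => (g z, z.2))
      (fun z => w z.1 z.2)); last exact: wc.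
    exact: cont_pair.
  have cn (g : ('cV[R]_N * 'cV[R]_N) * R -> 'cV[R]_N) : continuous g ->
      continuous (fun z => nsq (g z)).
    by move=> cg; exact: continuous_dotp.
  apply: contB.
    by apply: contM; [exact: cont_cst|apply: contB; exact: wc'].
  apply: contM; first exact: cont_cst.
  apply: contD; last by apply: contB; [exact: cont_cst|exact: c3].
  apply: contD; last first.
    by apply: contD; apply: cn; apply: contB => //; exact: cont_cst.
  apply: contB.
    apply: contM; first exact: cont_cst.
    by apply: continuous_enorm; exact: contB.
  apply: contM; first exact: cont_cst.
  by apply: cn; exact: contB.
have A1 : A ((y1, y), s1).
  by split; [split|] => //=; rewrite ?in_itv /=;
    [rewrite /B /= subrr nsq0 ltW|lra].
have [[[Y Z] t] /set_mem cin cmax] : exists2 c, c \in A &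
    forall z, z \in A -> f z <= f c.
  apply: compact_EVT_max => //; first by exists ((y1, y), s1).
  exact: continuous_subspaceT.
have {}cmax z : A z -> f z <= f ((Y, Z), t) by move=> /mem_set/cmax.
move: cin => -[[/= BY BZ]]; rewrite /= in_itv /= => /andP [t1 t2].
have fpos : 0 < f ((Y, Z), t).
  apply: lt_le_trans (cmax _ A1); rewrite /f /Psi /= subrr nsq0 add0r subrr.
  have := mulr_ge0 (mulr_ge0 (ltW K0) (ltW b0)) (nsq_ge0 (y1 - y)); nra.
have /andP [wY0 wYK] := hw Y t BY t1 t2.
have /andP [wZ0 wZK] := hw Z t BZ t1 t2.
have e2r : enorm (Y - Z) <= 2 * r.
  have -> : Y - Z = (Y - y1) + - (Z - y1) by rewrite opprB addrA subrK.
  apply: le_trans (enormD _ _) _.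
  have h1 : enorm (Y - y1) <= r by rewrite enorm_le // ltW.
  have h2 : enorm (- (Z - y1)) <= r by rewrite enorm_le ?nsqN // ltW.
  lra.
(* Since |Y - Z| <= 2 r, the choice 2 * b for the linear coefficient keeps
   the concave part of the barrier nonnegative. *)
have pen : 0 <= 2 * b * r * enorm (Y - Z) - b * nsq (Y - Z).
  rewrite -enorm_sqr.
  have -> : 2 * b * r * enorm (Y - Z) - b * enorm (Y - Z) ^+ 2 =
    b * (enorm (Y - Z) * (2 * r - enorm (Y - Z))) by ring.
  by rewrite mulr_ge0 ?(ltW b0) // mulr_ge0 ?enorm_ge0 // subr_ge0.
have nY := nsq_ge0 (Y - y1); have nZ := nsq_ge0 (Z - y1).
have Psilt : K * Psi Y Z t < K * r ^+ 2.
  move: fpos; rewrite /f /=; nra.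
move: (Psilt); rewrite ltr_pM2l // /Psi => Psilt'.
have {BY} BY : nsq (Y - y1) < r ^+ 2 by lra.
have {BZ} BZ : nsq (Z - y1) < r ^+ 2 by lra.
have {t1} t1 : s1 - r ^+ 2 < t by lra.
(* The barrier is not smooth on the diagonal, but f is nonpositive there. *)
have xi0 : Y - Z != 0.
  apply: contraTneq fpos => /subr0_eq YZ; rewrite /f /= YZ subrr mulr0 sub0r.
  rewrite -leNgt oppr_le0 mulr_ge0 ?(ltW K0) //.
  by rewrite /Psi; move: pen; rewrite YZ; lra.
have [dY [HY [dtY d2Y eY]]] := wsol Y t.
have [dZ [HZ [dtZ d2Z eZ]]] := wsol Z t.
have htime : 0 <= r ^+ 2 * (dY - dZ) + K.
  have := @is_derive_left_max _ (fun s => f ((Y, Z), s)) t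
    (r ^+ 2 * (dY - dZ) + K) (t - (s1 - r ^+ 2)).
  apply.
  - have h := is_deriveD (is_deriveZ (r ^+ 2) (is_deriveB dtY dtZ))
      (is_derive_affine (- K * (Psi Y Z 0)) K t).
    apply: is_derive_ext h => // s.
    rewrite /f /Psi /= /GRing.scale /= !fctE; rewrite /= /GRing.scale /=; ring.
  - lra.
  - move=> s hs1 hs2; apply: cmax.
    by split; [split; exact: ltW|rewrite /= in_itv /=; lra].
have [eltS bndS] := ell t.
have [eta Seta etaL] := bndS (Y - Z).
have [n n1 [c hc sc]] := reflection_step Seta xi0.
pose a i := S t *m refl 0 i; pose a' i := S t *m refl n i.
have hspace i : r ^+ 2 * (HY (a i) - HZ (a' i)) <=
    2 * K * (nsq (a i) + nsq (a' i) - b * nsq (Y - Z) * c i ^+ 2).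
  have aa : a i - a' i = c i *: (Y - Z) by rewrite /a refl0; exact: hc.
  have h : has_d2 (fun s => (r ^+ 2 * (w (Y + s *: a i) t +
     (-1) * w (Z + s *: a' i) t)) +
     (- K) * ((2 * b * r * enorm (Y - Z) - b * nsq (Y - Z)
        + (nsq (Y - y1) + nsq (Z - y1)) + (s1 - t))
      + (2 * b * r * enorm (Y - Z) * c i - b * nsq (Y - Z) * (2 * c i)
        + (2 * dotp (Y - y1) (a i) + 2 * dotp (Z - y1) (a' i))) * s
      + (nsq (a i) + nsq (a' i) - b * nsq (Y - Z) * c i ^+ 2) * s ^+ 2))
     (r ^+ 2 * (HY (a i) + (-1) * HZ (a' i)) +
      (- K) * (2 * (nsq (a i) + nsq (a' i) - b * nsq (Y - Z) * c i ^+ 2))).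
    apply: has_d2D; apply: has_d2Z; last exact: has_d2_quadratic.
    by apply: has_d2D => //; apply: has_d2Z.
  suff : r ^+ 2 * (HY (a i) + (-1) * HZ (a' i)) +
      (- K) * (2 * (nsq (a i) + nsq (a' i) - b * nsq (Y - Z) * c i ^+ 2)) <= 0.
    by clear; lra.
  apply: has_d2_max h _.
  have nY' := near_lt_line (a i) BY; have nZ' := near_lt_line (a' i) BZ.
  have nc : \forall s \near (0 : R), 0 < 1 + c i * s.
    have cl : continuous (fun s : R => 1 + c i * s).
      apply: contD; first exact: cont_cst.
      by apply: contM; [exact: cont_cst|exact: cont_id].
    by have := cl 0; rewrite /continuous_at mulr0 addr0 => /cvgr_gt; apply.
  apply: filterS3 nY' nZ' nc => s s1' s2' s3'.
  have := cmax ((Y + s *: a i, Z + s *: a' i), t) _.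
  rewrite /f /Psi /=.
  have -> : Y + s *: a i - (Z + s *: a' i) = (1 + c i * s) *: (Y - Z).
    rewrite scalerDl scale1r mulrC -scalerA -aa scalerBr opprD.
    by rewrite !addrA; congr (_ - _); rewrite addrAC.
  rewrite enormZ gtr0_norm // nsqZ.
  rewrite !(addrAC _ (s *: _) (- y1)) !nsq_line => h.
  rewrite !scale0r !addr0.
  have /h : A (Y + s *: a i, Z + s *: a' i, t).
    split; [split|]; rewrite /B /= ?in_itv /=; last by rewrite (ltW t1) t2.
      by rewrite addrAC ltW.
    by rewrite addrAC ltW.
  by clear; lra.
have hsum : r ^+ 2 * (dY - dZ) <= 2 * K * (\sum_i nsq (a i) +
    \sum_i nsq (a' i) - b * nsq (Y - Z) * (4 / nsq eta)).
  rewrite (eY 0 (or_introl erefl)) (eZ n (or_intror n1)) -sc.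
  rewrite -sumrB mulr_sumr [X in _ <= _ * (_ - X)]mulr_sumr.
  rewrite -big_split -sumrB mulr_sumr; apply: ler_sum => i _.
  exact: hspace.
have ha : \sum_i nsq (a i) <= N%:R * L.
  apply: sum_nsq_le => i; apply: le_trans (eltS _) _.
  by rewrite refl0 nsq_delta mulr1.
have ha' : \sum_i nsq (a' i) <= N%:R * L.
  apply: sum_nsq_le => i; apply: le_trans (eltS _) _.
  by rewrite nsq_refl // mulr1.
have eta0 : 0 < nsq eta.
  rewrite lt_neqAle nsq_ge0 andbT eq_sym; apply: contra xi0 => /eqP/nsq_eq0 e0.
  by rewrite -Seta e0 mulmx0.
(* This is where the value of b comes from: the gain of the reflected
   coupling exceeds the loss 2 N L of the localizing terms. *)
have hb : 4 * (N%:R * L + 1) <= b * nsq (Y - Z) * (4 / nsq eta).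
  rewrite mulrA ler_pdivlMr // /b.
  have : 0 <= N%:R * L + 1 by rewrite addr_ge0 // mulr_ge0 // ltW.
  by clear -etaL; nra.
have NL0 : 0 <= N%:R * L by rewrite mulr_ge0 // ltW.
by clear -NL0 K0 htime hsum ha ha' hb; nra.
Qed.

(** * Spreading of positivity *)

Lemma continuous_sub_div (R : realType) (T : topologicalType) (f g h : T -> R)
    x : continuous f -> continuous g -> continuous h -> h x != 0 ->
  {for x, continuous (fun z => g z / h z - f z)}.
Proof.
move=> cf cg ch h0; apply: cvgB; last exact: cf.
by apply: cvgM; [exact: cg|apply: cvgV => //; exact: ch].
Qed.

Lemma is_derive_inv_exp (R : realType) (a s : R) (m : nat) : a + s != 0 ->
  is_derive s (1 : R) (fun s => ((a + s) ^+ m)^-1)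
    (- m%:R * ((a + s) ^+ m)^-1 / (a + s)).
Proof.
move=> as0; have h := is_deriveX m (is_derive_affine a 1 s).
have as0' : (fun s : R => a + 1 * s) s != 0 by rewrite mul1r.
have := @is_deriveV _ ((fun s : R => a + 1 * s) ^+ m) s _ 1 _ h.
have E x : ((fun s : R => a + 1 * s) ^+ m) x = (a + x) ^+ m.
  rewrite -[in RHS](mul1r x).
    by elim: m {h} => [|k IH]; rewrite ?expr0 // !exprS -IH.
rewrite E expf_neq0 // => /(_ isT); apply: is_derive_ext => [x|].
  by rewrite E.
rewrite /GRing.scale /= mul1r mulr1 expr2.
case: m {h E} => [|m]; first by rewrite mul0r oppr0 !mul0r mulr0.
by rewrite /= exprS; field; rewrite as0 expf_neq0.
Qed.

Lemma sum_dotp_sqr (R : realType) N (S : 'M[R]_N) (x : 'cV[R]_N) :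
  \sum_(i < N) dotp x (S *m delta_mx i 0) ^+ 2 = nsq (S^T *m x).
Proof.
apply: eq_bigr => i _.
by rewrite dotpC dotp_mulmx dotpC dotp_delta expr2.
Qed.

(** The lower bound passes to the transpose by duality: |x|^2 = <S y, x> = <y, S^T x>. *)
Lemma nsq_trmx_ge (R : realType) N (L : R) (S : 'M[R]_N) (x : 'cV[R]_N) :
  (exists2 y, S *m y = x & nsq y <= L * nsq x) ->
  nsq x <= L * nsq (S^T *m x).
Proof.
move=> [y yx yL]; have [x0|x0] := eqVneq (nsq x) 0.
  by rewrite x0 (nsq_eq0 x0) mulmx0 nsq0 mulr0.
have xp : 0 < nsq x by rewrite lt_neqAle eq_sym x0 nsq_ge0.
have := cauchy_schwarz y (S^T *m x); rewrite -dotp_mulmx yx -/(nsq x) expr2.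
move=> h; rewrite -(ler_pM2l xp); apply: (le_trans h).
by have := nsq_ge0 (S^T *m x); nra.
Qed.

(** The quadratic form in (tau, p) whose positivity makes the barrier below a strict
    subsolution; the hypothesis is that its discriminant is negative. *)
Lemma barrier_pos (R : realType) (C m tau p : R) : 0 < tau ->
  (C + 6) ^+ 2 < 16 * m -> 0 < 4 * tau - (C + 6) * p + m * p ^+ 2 / tau.
Proof.
move=> tau0 hm.
have -> : 4 * tau - (C + 6) * p + m * p ^+ 2 / tau =
  ((8 * tau - (C + 6) * p) ^+ 2 + (16 * m - (C + 6) ^+ 2) * p ^+ 2)
  / (16 * tau) by field; rewrite lt0r_neq0.
apply: divr_gt0; last by rewrite mulr_gt0.
have [->|p0] := eqVneq p 0.
  by rewrite mulr0 subr0 expr0n /= mulr0 addr0 exprn_gt0 // mulr_gt0.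
by rewrite ltr_wpDl ?sqr_ge0 // mulr_gt0 ?subr_gt0 // exprn_even_gt0.
Qed.

(** Comparison with the barrier c p^2 / tau^m, p = tau - beta |y - y1|^2, which lives
    inside a growing paraboloid and vanishes to second order on its boundary. There
    beta |y - y1|^2 = tau and the squared gradient dominates; inside, the decay rate m
    absorbs the remaining terms. On the initial slice the paraboloid is the ball where
    w >= h. With
    tau0 = beta * rho, waiting until tau costs the factor (tau0 / tau)^(m - 2). *)
Lemma positivity_spreads (R : realType) N (L : R) (S : R -> 'M[R]_N)
    (w : 'cV[R]_N -> R -> R) (m : nat) (beta := L / 2) :
  0 < L -> elliptic L S -> solution S w ->
  (2 * N%:R * L ^+ 2 + 6) ^+ 2 < 16 * m%:R ->
  (forall y t, 0 <= w y t) ->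
  forall y1 s1 rho h, 0 < rho -> 0 <= h ->
  (forall y, nsq (y - y1) <= rho -> h <= w y s1) ->
  forall y s (tau := s - s1 + beta * rho) (p := tau - beta * nsq (y - y1)),
  s1 <= s -> 0 <= p ->
  h * (beta * rho) ^+ m / (beta * rho) ^+ 2 * p ^+ 2 / tau ^+ m <= w y s.
Proof.
move=> L0 ell [wc wsol] hm w0 y1 s1 rho h rho0 h0 hw y s tau p s1s p0.
have be0 : 0 < beta by rewrite divr_gt0.
pose tau0 := beta * rho; have tau00 : 0 < tau0 by rewrite mulr_gt0.
rewrite -/tau0 in tau p p0 *.
pose c := h * tau0 ^+ m / tau0 ^+ 2.
pose T t := (tau0 - s1) + t.
pose P x t := T t - beta * nsq (x - y1).
pose f (z : 'cV[R]_N * R) := c * P z.1 z.2 ^+ 2 / T z.2 ^+ m - w z.1 z.2.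
rewrite -/c leNgt; apply/negP => hlt.
(* The maximum of f is sought over the paraboloid P >= 0 up to time s, cut out
   of a cylinder to have a compact set. *)
pose A := ([set x | nsq (x - y1) <= T s / beta] `*` `[s1, s]%classic) `&`
  [set z | - P z.1 z.2 <= 0].
have Tge t : s1 <= t -> tau0 <= T t by rewrite /T; lra.
have T0 t : s1 <= t -> 0 < T t by move=> /Tge; apply: lt_le_trans.
have inA x t : s1 <= t -> t <= s -> 0 <= P x t -> A (x, t).
  move=> st ts Px; split; last by rewrite /= oppr_le0.
  split; last by rewrite /= in_itv /= st ts.
  rewrite /= ler_pdivlMr // mulrC.
  by move: Px; rewrite /P /T; lra.
have cP : continuous (fun z : 'cV[R]_N * R => P z.1 z.2).
  apply: contB.
    by apply: contD; [exact: cont_cst|apply: cont_snd; exact: cont_id].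
  apply: contM; first exact: cont_cst.
  by apply: continuous_dotp; (apply: contB;
    [apply: cont_fst; exact: cont_id|exact: cont_cst]).
have cA : compact A.
  apply: compact_closedI.
    by apply: compact_setX; [exact: compact_ball|exact: segment_compact].
  apply: closed_le_cont => z; apply: cvgN; exact: cP.
have cf : {within A, continuous f}.
  apply: continuous_in_subspaceT => z /set_mem [[_ /=]].
  rewrite in_itv /= => /andP [sz _] _.
  apply: (@continuous_sub_div _ _ (fun z => w z.1 z.2)
    (fun z => c * P z.1 z.2 ^+ 2) (fun z => T z.2 ^+ m)) => //.
  - apply: contM; first exact: cont_cst.
    by apply: (@contM _ _ (fun z => P z.1 z.2) (fun z => P z.1 z.2)).
  - move=> x; apply: (@continuous_comp _ _ _ (fun z : 'cV[R]_N * R => T z.2)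
      (fun r => r ^+ m)); last exact: exprn_continuous.
    move: x; apply: contD; first exact: cont_cst.
    by apply: cont_snd; exact: cont_id.
  - by rewrite expf_neq0 // lt0r_neq0 // T0.
have Ays : A (y, s) by apply: inA => //; move: p0; rewrite /p /P /T /tau; lra.
have [[Y t] /set_mem cin cmax] : exists2 c, c \in A &
    forall z, z \in A -> f z <= f c.
  by apply: compact_EVT_max => //; exists (y, s).
have {}cmax x u : s1 <= u -> u <= s -> 0 <= P x u -> f (x, u) <= f (Y, t).
  by move=> h1 h2 h3; apply: cmax; apply/mem_set; exact: inA.
move: cin => [[_ /=]]; rewrite in_itv /= oppr_le0 => /andP [st ts] P0.
have fpos : 0 < f (Y, t).
  apply: lt_le_trans (cmax y s s1s (lexx _) _).
    rewrite /f /= subr_gt0; move: hlt; rewrite /p /P /T /tau.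
    by rewrite (_ : s - s1 + tau0 = tau0 - s1 + s) //; ring.
  by case: Ays => _ /=; rewrite oppr_le0.
have c0 : 0 <= c by rewrite divr_ge0 ?mulr_ge0 ?exprn_ge0 // ltW.
have Tt0 := T0 t st.
have wYt := w0 Y t.
have Tm0 : 0 < T t ^+ m by rewrite exprn_gt0.
have cP0 : 0 < c * P Y t ^+ 2.
  have : 0 < c * P Y t ^+ 2 / T t ^+ m.
    by move: fpos; rewrite /f /=; lra.
  by rewrite pmulr_lgt0 // invr_gt0.
have {c0} c0 : 0 < c.
  rewrite lt_neqAle c0 andbT; apply: contraTneq cP0 => <-.
  by rewrite mul0r ltxx.
have {P0} P0 : 0 < P Y t.
  rewrite lt_neqAle P0 andbT; apply: contraTneq cP0 => <-.
  by rewrite expr0n /= mulr0 ltxx.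
have {st} st : s1 < t.
  rewrite lt_neqAle st andbT; apply: contraTneq fpos => st'.
  have Tt : T t = tau0 by rewrite /T -st'; ring.
  rewrite -leNgt /f /= subr_le0 Tt -st'.
  have PT : P Y t <= tau0.
    by rewrite /P Tt gerBl mulr_ge0 ?nsq_ge0 // ltW.
  apply: (@le_trans _ _ h).
    rewrite -st' in PT P0; rewrite /c (_ : _ / _ = h * (P Y s1 / tau0) ^+ 2).
      have q0 : 0 <= P Y s1 / tau0 by apply: divr_ge0; exact: ltW.
      by rewrite ler_piMr // expr_le1 // ler_pdivrMr ?mul1r.
    by field; rewrite expf_neq0 ?lt0r_neq0.
  apply: hw; move: P0; rewrite /P Tt /tau0 -mulrBr pmulr_rgt0 // subr_gt0.
  exact: ltW.
have [d [H [dt d2 eH]]] := wsol Y t.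
pose I := (T t ^+ m)^-1.
have I0 : 0 < I by rewrite invr_gt0.
have htime : 0 <= c * I * (2 * P Y t - m%:R * P Y t ^+ 2 / T t) - d.
  have := @is_derive_left_max _ (fun s => f (Y, s)) t
    (c * I * (2 * P Y t - m%:R * P Y t ^+ 2 / T t) - d)
    (Num.min (t - s1) (P Y t)).
  apply.
  - pose a := tau0 - s1 - beta * nsq (Y - y1).
    have h1 := is_derive_quadratic (a ^+ 2) (2 * a) 1 t.
    have h2 := @is_derive_inv_exp _ (tau0 - s1) t m (lt0r_neq0 Tt0).
    have h3 := is_deriveB (is_deriveZ c (is_deriveM h1 h2)) dt.
    apply: is_derive_ext h3 => [u|].
      by rewrite /f /= !fctE /= /P /T /GRing.scale /= /a; ring.
    rewrite /GRing.scale /= -/(T t) -/I.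
    have -> : P Y t = a + t by rewrite /P /T /a; ring.
    by ring.
  - by rewrite lt_min subr_gt0 st P0.
  - move=> u; rewrite ltrBlDl -ltrBlDr lt_min => /andP [u1 u2] ut.
    apply: cmax; [|exact: le_trans ut ts|]; first by clear -u1; lra.
    by move: u2; rewrite /P /T; lra.
have [eltS bndS] := ell t.
pose a i := S t *m refl 0 i.
have hspace i : c * I * (8 * beta ^+ 2 * dotp (Y - y1) (a i) ^+ 2
    - 4 * P Y t * beta * nsq (a i)) <= H (a i).
  have h' : has_d2 (fun s => c * I *
     ((P Y t + (- 2 * beta * dotp (Y - y1) (a i)) * s
        + (- beta * nsq (a i)) * s ^+ 2) ^+ 2) + (-1) * w (Y + s *: a i) t)
     (c * I * (2 * (- 2 * beta * dotp (Y - y1) (a i)) ^+ 2 +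
       4 * P Y t * (- beta * nsq (a i))) + (-1) * H (a i)).
    apply: has_d2D; apply: has_d2Z => //; exact: has_d2_quadratic_sqr.
  suff : c * I * (2 * (- 2 * beta * dotp (Y - y1) (a i)) ^+ 2 +
       4 * P Y t * (- beta * nsq (a i))) + (-1) * H (a i) <= 0.
    have -> : 2 * (- 2 * beta * dotp (Y - y1) (a i)) ^+ 2 +
       4 * P Y t * (- beta * nsq (a i)) =
      8 * beta ^+ 2 * dotp (Y - y1) (a i) ^+ 2
       - 4 * P Y t * beta * nsq (a i) by ring.
    lra.
  apply: has_d2_max h' _.
  have nY : nsq (Y - y1) < T t / beta.
    by rewrite ltr_pdivlMr // mulrC -subr_gt0.
  have nY' := near_lt_line (a i) nY.
  near=> u.
  have u1 : nsq (Y - y1 + u *: a i) < T t / beta by near: u.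
  have Pu : P (Y + u *: a i) t = P Y t + (- 2 * beta * dotp (Y - y1) (a i)) * u
        + (- beta * nsq (a i)) * u ^+ 2.
    by rewrite /P (addrAC Y) nsq_line; ring.
  rewrite -Pu scale0r addr0 mulr0 expr0n /= mulr0 !addr0.
  have := cmax (Y + u *: a i) t (ltW st) ts.
  rewrite /f /= -/I => hh.
  suff /hh {}hh : 0 <= P (Y + u *: a i) t by clear -hh; lra.
  by rewrite /P subr_ge0 mulrC -ler_pdivlMr // (addrAC Y) ltW.
have hsum : c * I * (8 * beta ^+ 2 * nsq ((S t)^T *m (Y - y1))
    - 4 * P Y t * beta * \sum_i nsq (a i)) <= d.
  rewrite (eH 0 (or_introl erefl)) -sum_dotp_sqr.
  rewrite !mulr_sumr -sumrB mulr_sumr; apply: ler_sum => i _.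
  by have := hspace i; rewrite /a refl0.
have ha : \sum_i nsq (a i) <= N%:R * L.
  apply: sum_nsq_le => i; apply: le_trans (eltS _) _.
  by rewrite refl0 nsq_delta mulr1.
have hx := nsq_trmx_ge (bndS (Y - y1)).
(* At a positive interior maximum the derivative tests contradict the strict
   subsolution inequality. *)
have key := barrier_pos (P Y t) Tt0 hm.
have k1 : 4 * (T t - P Y t) <= 8 * beta ^+ 2 * nsq ((S t)^T *m (Y - y1)).
  by rewrite /P opprB addrC subrK /beta; clear -hx L0; nra.
have k2 : 4 * P Y t * beta * \sum_i nsq (a i) <= 2 * N%:R * L ^+ 2 * P Y t.
  have -> : 2 * N%:R * L ^+ 2 * P Y t = 4 * P Y t * beta * (N%:R * L).
    by rewrite /beta; field.
  by rewrite ler_pM2l // !mulr_gt0.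
have cI : 0 < c * I by rewrite mulr_gt0.
have : 0 < c * I * (8 * beta ^+ 2 * nsq ((S t)^T *m (Y - y1))
    - 4 * P Y t * beta * \sum_i nsq (a i) -
   (2 * P Y t - m%:R * P Y t ^+ 2 / T t)).
  by rewrite pmulr_rgt0 //; clear -key k1 k2; lra.
by rewrite mulrBr; clear -hsum htime; lra.
Unshelve. all: by end_near. Qed.

(** * The Harnack inequality *)

Lemma sqrt_le_sqr (R : realType) (a r : R) : 0 <= a -> 0 <= r ->
  (Num.sqrt a <= r) = (a <= r ^+ 2).
Proof.
by move=> a0 r0; rewrite -[in RHS](sqr_sqrtr a0) ler_pXn2r ?nnegrE ?sqrtr_ge0.
Qed.

(** Maximize w weighted by a power of the parabolic distance d to the boundary of the
    cylinder. On the cylinder of radius d / 2 below the maximum the distance is still at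
    least d / 2, so w is at most 4^k times as large there as at the maximum. *)
Lemma point_picking (R : realType) N (w : 'cV[R]_N -> R -> R) (k : nat) :
  continuous (fun z => w z.1 z.2) -> (forall y t, 0 <= w y t) -> (0 < k)%N ->
  forall x t rad, 0 < rad -> 0 < w x t ->
  exists y1 s1 d,
   [/\ 0 < d <= rad, nsq (y1 - x) <= rad ^+ 2, t - rad ^+ 2 <= s1 <= t,
     w x t * rad ^+ (2 * k) <= w y1 s1 * d ^+ (2 * k) &
     forall y s, nsq (y - y1) <= (d / 2) ^+ 2 -> s1 - (d / 2) ^+ 2 <= s ->
       s <= s1 -> w y s <= 4 ^+ k * w y1 s1].
Proof.
move=> cw w0 k0 x t rad rad0 V0.
pose d := (fun z : 'cV[R]_N * R => rad - enorm (z.1 - x)) \min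
  (fun z => rad - Num.sqrt (t - z.2)).
pose f z := w z.1 z.2 * d z ^+ (2 * k).
pose A := [set y | nsq (y - x) <= rad ^+ 2] `*` `[t - rad ^+ 2, t]%classic.
have cA : compact A.
  by apply: compact_setX; [exact: compact_ball|exact: segment_compact].
have cf : continuous f.
  apply: contM => // z; apply: (@continuous_comp _ _ _ d (fun r => r ^+ _));
    last exact: exprn_continuous.
  apply: continuous_min; move: z.
    apply: contB; first exact: cont_cst.
    apply: continuous_enorm; apply: contB; last exact: cont_cst.
    by apply: cont_fst; exact: cont_id.
  apply: contB; first exact: cont_cst.
  move=> z; apply: (@continuous_comp _ _ _ (fun z : 'cV[R]_N * R => t - z.2)
    Num.sqrt); last exact: sqrt_continuous.
  move: z; apply: contB; first exact: cont_cst.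
  by apply: cont_snd; exact: cont_id.
have rr0 : 0 < rad ^+ 2 by rewrite exprn_gt0.
have Axt : A (x, t).
  by split; rewrite /= ?subrr ?nsq0 ?in_itv /=; lra.
have [[y1 s1] /set_mem cin cmax] : exists2 c, c \in A &
    forall z, z \in A -> f z <= f c.
  apply: compact_EVT_max => //; first by exists (x, t).
  exact: continuous_subspaceT.
have {}cmax z : A z -> f z <= f (y1, s1) by move=> /mem_set/cmax.
move: cin => [/= hy1]; rewrite in_itv /= => /andP [s1l s1r].
have dxt : d (x, t) = rad.
  by rewrite /d /= !subrr sqrtr0 /enorm -/(nsq _) nsq0 sqrtr0 subr0 minxx.
have d1ge : 0 <= d (y1, s1).
  rewrite /d /= le_min !subr_ge0 enorm_le ?(ltW rad0) // hy1 /=.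
  by rewrite sqrt_le_sqr ?subr_ge0 ?(ltW rad0) //; lra.
have fle := cmax _ Axt; rewrite /f /= dxt in fle.
have d1gt : 0 < d (y1, s1).
  rewrite lt_neqAle d1ge andbT; apply: contraTneq fle => <-.
  rewrite expr0n muln_eq0 /= (gtn_eqF k0) mulr0 -ltNge.
  by rewrite mulr_gt0 // exprn_gt0.
pose r := d (y1, s1) / 2.
have r0 : 0 < r by rewrite divr_gt0.
exists y1, s1, (d (y1, s1)); split => //.
- by rewrite d1gt /d /= ge_min gerBl enorm_ge0.
- by rewrite s1l s1r.
move=> y s; rewrite -/r => hy hs1 hs2.
have dr : r <= d (y, s).
  have : d (y1, s1) <= rad - enorm (y1 - x) by rewrite /d /= ge_min lexx.
  have : d (y1, s1) <= rad - Num.sqrt (t - s1).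
    by rewrite /d /= ge_min lexx orbT.
  have dE : d (y1, s1) = 2 * r by rewrite /r; field.
  rewrite dE => h1 h2; rewrite /d /= le_min; apply/andP; split.
    have -> : y - x = (y - y1) + (y1 - x) by rewrite addrA subrK.
    have := enormD (y - y1) (y1 - x).
    have : enorm (y - y1) <= r by rewrite enorm_le // ltW.
    lra.
  suff : Num.sqrt (t - s) <= Num.sqrt (t - s1) + r by lra.
  have q0 := sqrtr_ge0 (t - s1).
  rewrite sqrt_le_sqr; [|lra|lra].
  have q1 : Num.sqrt (t - s1) ^+ 2 = t - s1 by rewrite sqr_sqrtr //; lra.
  rewrite sqrrD q1; have := mulr_ge0 q0 (ltW r0); rewrite mulr2n; lra.
have Ays : A (y, s).
  have d0 := lt_le_trans r0 dr.
  split; rewrite /=.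
    rewrite -enorm_le ?(ltW rad0) // -subr_ge0.
    by apply: le_trans (ltW d0) _; rewrite /d /= ge_min lexx.
  rewrite in_itv /=; apply/andP; split; last lra.
  suff : t - s <= rad ^+ 2 by lra.
  rewrite -sqrt_le_sqr ?(ltW rad0) //; last lra.
  by rewrite -subr_ge0; apply: le_trans (ltW d0) _; rewrite /d /= ge_min lexx orbT.
have := cmax _ Ays; rewrite /f /= => h.
have rk : 0 < r ^+ (2 * k) by rewrite exprn_gt0.
rewrite -(ler_pM2r rk); apply: (@le_trans _ _ (w y s * d (y, s) ^+ (2 * k))).
  by rewrite ler_wpM2l // lerXn2r // nnegrE ?ltW // (lt_le_trans r0).
apply: (le_trans h); rewrite le_eqVlt; apply/orP; left; apply/eqP.
have -> : d (y1, s1) = 2 * r by rewrite /r; field.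
rewrite exprMn (exprM 2) -natrX; ring.
Qed.

(** Pick (y1, s1) near (x, t). There w is bounded by a multiple of w1 = w y1 s1, so the
    Lipschitz bound keeps w >= w1 / 2 on a ball of radius comparable to d at time s1,
    and positivity spreads from it to (x0, t0) at the price (d / rad)^(2 k). The weight
    used in the picking has the same exponent, so the height w1 pays for the smallness
    of the ball exactly. *)
Lemma harnack (R : realType) N (L : R) (S : R -> 'M[R]_N) :
  0 < L -> elliptic L S ->
  exists C kappa : R, [/\ 0 < C, 0 < kappa &
  forall w, solution S w -> (forall y t, 0 <= w y t) ->
  forall x0 t0 x t, t < t0 -> kappa * nsq (x0 - x) <= t0 - t ->
  w x t <= C * w x0 t0].
Proof.
move=> L0 ell.
pose beta := L / 2; pose b := L * (N%:R * L + 1).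
have be0 : 0 < beta by rewrite divr_gt0.
have NL0 : 0 <= N%:R * L by rewrite mulr_ge0 // ltW.
have b0 : 0 < b by rewrite mulr_gt0 // ltr_wpDl.
pose q := (2 * N%:R * L ^+ 2 + 6) ^+ 2.
have [k k0 hk] : exists2 k, (0 < k)%N & q < 16 * (k.+2)%:R.
  exists (Num.bound q).+1 => //; apply: (@lt_le_trans _ _ (Num.bound q)%:R).
    by apply: archi_boundP; exact: sqr_ge0.
  rewrite -natrM ler_nat; lia.
(* theta * r is the radius on which the Lipschitz bound costs at most half of
   the height; see thE. *)
pose theta := (4 ^+ k * (2 * (2 * b + 1)))^-1.
have k40 : 0 < (4 : R) ^+ k by rewrite exprn_gt0.
have k41 : 1 <= (4 : R) ^+ k by rewrite exprn_ege1 // ler1n.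
have th0 : 0 < theta by rewrite invr_gt0 mulr_gt0 //; lra.
have thE : 4 ^+ k * ((2 * b + 1) * theta) = 1 / 2.
  rewrite /theta; field; rewrite (lt0r_neq0 k40) andbT lt0r_neq0 //; lra.
have th1 : theta <= 1.
  have b1 : 1 <= 2 * (2 * b + 1) by lra.
  have h : 1 <= 4 ^+ k * (2 * (2 * b + 1)).
    by rewrite -[X in X <= _]mulr1 ler_pM.
  by rewrite invf_le1 // (lt_le_trans ltr01).
pose g := beta * theta ^+ 2 / 4 / (9 * beta + 1).
have g0 : 0 < g.
  by apply: divr_gt0; [rewrite divr_gt0 // mulr_gt0 // exprn_gt0|lra].
exists (8 / g ^+ k), (8 * beta); split; [|by rewrite mulr_gt0|].
  by rewrite divr_gt0 // exprn_gt0.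
move=> w wsol w0 x0 t0 x t tt0 hx.
have [V0|V0] := leP (w x t) 0.
  by apply: (le_trans V0); rewrite mulr_ge0 // ltW // divr_gt0 // exprn_gt0.
(* This radius makes the spreading paraboloid of opening beta reach x0 from
   any point of the cylinder, with the factor 1 / 2 of hp to spare. *)
pose rad := Num.sqrt ((t0 - t) / (8 * beta)).
have rad0 : 0 < rad by rewrite sqrtr_gt0 divr_gt0 ?subr_gt0 ?mulr_gt0.
have radE : 8 * beta * rad ^+ 2 = t0 - t.
  rewrite sqr_sqrtr; last by rewrite divr_ge0 ?subr_ge0 ?ltW ?mulr_gt0.
  by rewrite mulrC divfK // lt0r_neq0 // mulr_gt0.
have [y1 [s1 [d [/andP [d0 drad] hy1 /andP [s1l s1r] hmax hcyl]]]] :=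
  point_picking (wsol.1) w0 k0 rad0 V0.
set w1 := w y1 s1 in hmax hcyl.
pose r := d / 2; have r0 : 0 < r by rewrite divr_gt0.
have rr0 : 0 < r ^+ 2 by rewrite exprn_gt0.
have w10 : 0 < w1.
  have : 0 < w1 * d ^+ (2 * k).
    by apply: lt_le_trans hmax; rewrite mulr_gt0 // exprn_gt0.
  by rewrite pmulr_lgt0 // exprn_gt0.
pose rho := (theta * r) ^+ 2.
have thr0 : 0 < theta * r by rewrite mulr_gt0.
have rho0 : 0 < rho by rewrite exprn_gt0.
have hhalf y : nsq (y - y1) <= rho -> w1 / 2 <= w y s1.
  move=> hy; have thr : theta * r <= r by rewrite ler_piMl // ltW.
  have hy' : nsq (y - y1) <= r ^+ 2.
    apply: (le_trans hy); rewrite lerXn2r // nnegrE; exact: ltW.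
  have := @solution_lipschitz _ _ _ _ _ L0 ell wsol (4 ^+ k * w1) r y1 s1 y
    (mulr_gt0 k40 w10) r0 _ hy'.
  rewrite -/b -/w1 => hl.
  have {hl} : r ^+ 2 * (w1 - w y s1) <=
      4 ^+ k * w1 * (2 * b * r * enorm (y1 - y) + nsq (y - y1)).
    by apply: hl => z s z1 z2 z3; rewrite w0 hcyl.
  have he : enorm (y1 - y) <= theta * r.
    by rewrite enorm_le ?(ltW thr0) // -opprB nsqN.
  have : 4 ^+ k * w1 * (2 * b * r * enorm (y1 - y) + nsq (y - y1)) <=
      r ^+ 2 * (w1 / 2).
    have -> : r ^+ 2 * (w1 / 2) = 4 ^+ k * w1 * ((2 * b + 1) * theta * r ^+ 2).
      transitivity (w1 * r ^+ 2 * (4 ^+ k * ((2 * b + 1) * theta))); last by ring.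
      by rewrite thE; ring.
    rewrite ler_pM2l ?mulr_gt0 //.
    have h1 : 2 * b * r * enorm (y1 - y) <= 2 * b * r * (theta * r).
      by rewrite ler_pM2l //; exact: mulr_gt0 (mulr_gt0 _ b0) r0.
    have h2 : theta ^+ 2 * r ^+ 2 <= theta * r ^+ 2.
      by rewrite ler_pM2r // expr2; exact: ler_piMl (ltW th0) th1.
    move: hy; rewrite /rho exprMn; lra.
  by move=> h1 h2; have := le_trans h2 h1; rewrite ler_pM2l //; lra.
have s10 : s1 <= t0 by lra.
pose tau0 := beta * rho.
have tau00 : 0 < tau0 by rewrite mulr_gt0.
pose tau := t0 - s1 + tau0.
have taup : 0 < tau by rewrite /tau; lra.
have hp : tau / 2 <= tau - beta * nsq (x0 - y1).
  have : nsq (x0 - y1) <= 2 * nsq (x0 - x) + 2 * rad ^+ 2.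
    have -> : x0 - y1 = (x0 - x) + - (y1 - x) by rewrite opprB addrA subrK.
    by apply: le_trans (nsqD_le _ _) _; rewrite nsqN; lra.
  rewrite -(ler_pM2l be0); rewrite /tau; nra.
have p0 : 0 <= tau - beta * nsq (x0 - y1).
  by apply: le_trans hp; rewrite divr_ge0 // ltW.
have := @positivity_spreads _ _ _ _ _ _ L0 ell wsol hk w0 y1 s1 rho (w1 / 2)
  rho0 (ltW (divr_gt0 w10 (ltr0Sn _ 1))) hhalf x0 t0 s10 p0.
rewrite -/beta -/tau0 -/tau; set p := tau - _ in hp p0 * => hw.
have gk0 : 0 < g ^+ k by rewrite exprn_gt0.
have tauk : 0 < tau ^+ k by rewrite exprn_gt0.
rewrite mulrAC ler_pdivlMr // mulrC.
have step1 : w1 * (tau0 / tau) ^+ k <= 8 * w x0 t0.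
  apply: (@le_trans _ _ (8 *
    (w1 / 2 * tau0 ^+ k.+2 / tau0 ^+ 2 * p ^+ 2 / tau ^+ k.+2))); last first.
    by rewrite ler_pM2l.
  have -> : 8 * (w1 / 2 * tau0 ^+ k.+2 / tau0 ^+ 2 * p ^+ 2 / tau ^+ k.+2) =
      w1 * (tau0 / tau) ^+ k * (p / (tau / 2)) ^+ 2.
    rewrite [(tau0 / tau) ^+ k]exprMn exprVn !exprS; field.
    by rewrite !lt0r_neq0 // exprn_gt0.
  rewrite ler_pMr; last by rewrite mulr_gt0 // exprn_gt0 // divr_gt0.
  by rewrite exprn_ege1 // ler_pdivlMr ?mul1r // divr_gt0.
apply: le_trans step1.
have rk0 : 0 < rad ^+ (2 * k) by rewrite exprn_gt0.
have step2 : g * d ^+ 2 / rad ^+ 2 <= tau0 / tau.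
  have -> : g * d ^+ 2 / rad ^+ 2 = tau0 / ((9 * beta + 1) * rad ^+ 2).
    rewrite /g /tau0 /rho /r; field.
    by rewrite lt0r_neq0 //= lt0r_neq0 //; lra.
  rewrite ler_pM2l // lef_pV2 ?posrE //; last first.
    by rewrite mulr_gt0 ?exprn_gt0 //; lra.
  have : tau0 <= beta * rad ^+ 2.
    rewrite ler_pM2l // /rho lerXn2r ?nnegrE ?(ltW thr0) ?(ltW rad0) //.
    rewrite /r; nra.
  rewrite /tau; lra.
apply: (@le_trans _ _ (w1 * (g * d ^+ 2 / rad ^+ 2) ^+ k)); last first.
  rewrite ler_pM2l // lerXn2r // nnegrE; last by rewrite divr_ge0 // ltW.
  by apply: divr_ge0; rewrite ?sqr_ge0 // mulr_ge0 ?sqr_ge0 // ltW.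
rewrite -(ler_pM2r rk0).
have := ler_wpM2l (ltW gk0) hmax; rewrite mulrA => /le_trans; apply.
clear -g rad0; clearbody g; rewrite !exprM [(_ / _) ^+ k]exprMn [(g * _) ^+ k]exprMn exprVn.
rewrite le_eqVlt; apply/orP; left; apply/eqP.
by field; rewrite lt0r_neq0 // !exprn_gt0.
Qed.

(** * The matrix exponential *)

Lemma cvg_pseries_factorial (R : realType) (a : R^nat) (D K : R) :
  0 <= D -> 0 <= K -> (forall k, `|a k| <= D * K ^+ k / k`!%:R) ->
  forall x, cvgn (pseries a x).
Proof.
move=> D0 K0 ha x; apply: normed_cvg.
apply: (@series_le_cvg _ _ (D *: exp_coeff (K * `|x|))).
- by move=> n; exact: normr_ge0.
- by move=> n; rewrite /= mulr_ge0 // exp_coeff_ge0 // mulr_ge0.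
- move=> n; have : `|a n * x ^+ n| <= D * ((K * `|x|) ^+ n / n`!%:R).
    have -> : D * ((K * `|x|) ^+ n / n`!%:R) = D * K ^+ n / n`!%:R * `|x| ^+ n.
      by rewrite exprMn; ring.
    by rewrite normrM normrX ler_wpM2r // exprn_ge0.
  exact.
- by apply: is_cvg_seriesZ; exact: is_cvg_series_exp_coeff.
Qed.

Lemma le_mx_norm (R : realType) m n (A : 'M[R]_(m, n)) i j : `|A i j| <= `|A|.
Proof.
rewrite [leRHS]/Num.Def.normr /= mx_normrE.
exact: (le_bigmax _ (fun ij : 'I_m * 'I_n => `|A ij.1 ij.2|) (i, j)).
Qed.

Lemma mx_expr_bound (R : realType) N (B : 'M[R]_N) k i j :
  `|(B ^+ k) i j| <= (N%:R * `|B| + 1) ^+ k.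
Proof.
have K0 : 0 <= N%:R * `|B| + 1 by rewrite addr_ge0 ?mulr_ge0.
elim: k i j => [|k IH] i j.
  by rewrite !expr0 mxE; case: (i == j); rewrite ?normr1 ?normr0.
rewrite !exprS mxE; apply: le_trans (ler_norm_sum _ _ _) _.
apply: (@le_trans _ _ (\sum_(l < N) `|B| * (N%:R * `|B| + 1) ^+ k)).
  by apply: ler_sum => l _; rewrite normrM ler_pM // le_mx_norm.
rewrite sumr_const card_ord -[_ * _ *+ N]mulr_natl mulrA ler_wpM2r ?exprn_ge0 //.
by rewrite lerDl.
Qed.

(** The matrix exponential is handled entry by entry, as a scalar power series in t. *)
Definition expmx_coef (R : realType) N (B : 'M[R]_N) (i j : 'I_N) : R^nat :=
  fun k => (B ^+ k) i j / k`!%:R.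

Lemma pseries_diffs_expmx (R : realType) N (B : 'M[R]_N) i j k :
  pseries_diffs (expmx_coef B i j) k = (B ^+ k.+1) i j / k`!%:R.
Proof.
rewrite /pseries_diffs /expmx_coef factS natrM invfM.
by rewrite [X in _ * X]mulrCA mulVKf // pnatr_eq0.
Qed.

Lemma pseries_diffs2_expmx (R : realType) N (B : 'M[R]_N) i j k :
  pseries_diffs (pseries_diffs (expmx_coef B i j)) k =
  (B ^+ k.+2) i j / k`!%:R.
Proof.
rewrite {1}/pseries_diffs pseries_diffs_expmx factS natrM invfM.
by rewrite [X in _ * X]mulrCA mulVKf // pnatr_eq0.
Qed.

(** The shift d covers the series and its two formal derivatives. *)
Lemma cvg_pseries_expmx (R : realType) N (B : 'M[R]_N) i j d (a : R^nat) x :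
  (forall k, a k = (B ^+ (d + k)) i j / k`!%:R) -> cvgn (pseries a x).
Proof.
move=> ha; have K0 : 0 <= N%:R * `|B| + 1 by rewrite addr_ge0 ?mulr_ge0.
apply: (@cvg_pseries_factorial _ _ ((N%:R * `|B| + 1) ^+ d) (N%:R * `|B| + 1)).
- exact: exprn_ge0.
- exact: K0.
move=> k; rewrite ha normrM normfV normr_nat -exprD ler_wpM2r ?invr_ge0 //.
exact: mx_expr_bound.
Qed.

Lemma mx_exprZ (R : realType) N (B : 'M[R]_N) t k :
  (t *: B) ^+ k = t ^+ k *: B ^+ k.
Proof.
elim: k => [|k IH]; first by rewrite !expr0 scale1r.
by rewrite !exprS IH -!mulmxE -scalemxAl -scalemxAr scalerA.
Qed.

Lemma cvg_expmx (R : realType) N (B : 'M[R]_N) t i j :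
  pseries (expmx_coef B i j) t @ \oo --> expmx (t *: B) i j.
Proof.
pose l : 'M[R]_N := \matrix_(i, j) limn (pseries (expmx_coef B i j) t).
have cl : series (fun k : nat => (k`!%:R)^-1 *: (t *: B) ^+ k) @ \oo --> l.
  apply: cvg_mx => i' j'; rewrite mxE.
  have -> : (fun n => (series (fun k : nat => (k`!%:R)^-1 *: (t *: B) ^+ k) n)
    i' j') = pseries (expmx_coef B i' j') t.
    apply/funext => n; rewrite /pseries /series /= summxE.
    apply: eq_bigr => k _; rewrite mx_exprZ !mxE /expmx_coef; ring.
  exact: (@cvg_pseries_expmx _ _ B i' j' 0).
have -> : expmx (t *: B) = l by exact: cvg_lim.
by rewrite mxE; exact: (@cvg_pseries_expmx _ _ B i j 0).
Qed.

Lemma cvg_pseries_mull (R : realType) N (B : 'M[R]_N) t i j :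
  pseries (pseries_diffs (expmx_coef B i j)) t @ \oo -->
  (B *m expmx (t *: B)) i j.
Proof.
rewrite mxE.
have -> : pseries (pseries_diffs (expmx_coef B i j)) t =
    (fun n => \sum_l B i l * pseries (expmx_coef B l j) t n).
  apply/funext => n; rewrite /pseries /series /=.
  under [RHS]eq_bigr do rewrite mulr_sumr.
  rewrite exchange_big /=; apply: eq_bigr => k _.
  rewrite pseries_diffs_expmx exprS -mulmxE mxE !mulr_suml.
  by apply: eq_bigr => l _; rewrite /expmx_coef; ring.
apply: cvg_big => [|l _]; first exact: add_continuous.
by apply: cvgM; [exact: cvg_cst|exact: cvg_expmx].
Qed.

Lemma cvg_pseries_mulr (R : realType) N (B : 'M[R]_N) t i j :
  pseries (pseries_diffs (expmx_coef B i j)) t @ \oo -->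
  (expmx (t *: B) *m B) i j.
Proof.
rewrite mxE.
have -> : pseries (pseries_diffs (expmx_coef B i j)) t =
    (fun n => \sum_l pseries (expmx_coef B i l) t n * B l j).
  apply/funext => n; rewrite /pseries /series /=.
  under [RHS]eq_bigr do rewrite mulr_suml.
  rewrite exchange_big /=; apply: eq_bigr => k _.
  rewrite pseries_diffs_expmx exprSr -mulmxE mxE !mulr_suml.
  by apply: eq_bigr => l _; rewrite /expmx_coef; ring.
apply: cvg_big => [|l _]; first exact: add_continuous.
by apply: cvgM; [exact: cvg_expmx|exact: cvg_cst].
Qed.

(** Both sides are limits of the formally differentiated series. *)
Lemma expmx_comm (R : realType) N (B : 'M[R]_N) t :
  B *m expmx (t *: B) = expmx (t *: B) *m B.
Proof.
apply/matrixP => i j.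
exact: cvg_unique (@cvg_pseries_mull _ _ B t i j) (@cvg_pseries_mulr _ _ B t i j).
Qed.

Lemma is_derive_expmx (R : realType) N (B : 'M[R]_N) (t : R) i j :
  is_derive t (1 : R) (fun t => expmx (t *: B) i j) ((B *m expmx (t *: B)) i j).
Proof.
have E : (fun t => expmx (t *: B) i j) =
    (fun t => limn (pseries (expmx_coef B i j) t)).
  by apply/funext => s; apply/esym/cvg_lim => //; exact: cvg_expmx.
rewrite E -(cvg_lim _ (@cvg_pseries_mull _ _ B t i j)) //.
apply: (@pseries_snd_diffs _ _ (`|t| + 1)).
- exact: (@cvg_pseries_expmx _ _ B i j 0).
- by apply: (@cvg_pseries_expmx _ _ B i j 1) => k; exact: pseries_diffs_expmx.
- by apply: (@cvg_pseries_expmx _ _ B i j 2) => k; exact: pseries_diffs2_expmx.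
- by rewrite [ltRHS]ger0_norm ?addr_ge0 // ltrDl.
Qed.

Lemma expmx0 (R : realType) N : expmx (0 : 'M[R]_N) = 1%:M.
Proof.
apply: cvg_lim => //; apply: cvg_near_cst; near=> n.
have n0 : (0 < n)%N by near: n; exact: nbhs_infty_gt.
rewrite /series /= -(prednK n0) big_nat_recl //= fact0 invr1 scale1r expr0.
by rewrite big1 ?addr0 // => k _; rewrite exprS mul0r scaler0.
Unshelve. all: by end_near. Qed.

Lemma is_derive_expmxN (R : realType) N (B : 'M[R]_N) (t : R) i j :
  is_derive t (1 : R) (fun t => expmx (- t *: B) i j)
    (- (B *m expmx (- t *: B)) i j).
Proof.
have h := is_derive1_comp (is_derive_expmx B (- t) i j) (is_deriveNid t 1).
by apply: is_derive_ext h => // ; rewrite mulrN1.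
Qed.

(** The derivative of exp(tB) exp(-tB) vanishes because B commutes with exp(tB). *)
Lemma expmxK (R : realType) N (B : 'M[R]_N) t :
  expmx (t *: B) *m expmx (- t *: B) = 1%:M.
Proof.
have <- : expmx (0 *: B) *m expmx (- 0 *: B) = 1%:M.
  by rewrite oppr0 scale0r expmx0 mulmx1.
apply/matrixP => i j.
apply: (@is_derive_0_is_cst _
  (fun t => (expmx (t *: B) *m expmx (- t *: B)) i j)) => s.
have h := is_derive_sum (fun l => is_deriveM (is_derive_expmx B s i l)
  (is_derive_expmxN B s l j)).
apply: is_derive_ext h => [x|].
  by rewrite fct_sumE mxE.
transitivity ((B *m expmx (s *: B) *m expmx (- s *: B)) i j -
   (expmx (s *: B) *m (B *m expmx (- s *: B))) i j); last first.
  by rewrite mulmxA -expmx_comm subrr.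
rewrite [X in _ = X - _]mxE [X in _ = _ - X]mxE -sumrB; apply: eq_bigr => l _.
by rewrite /GRing.scale /=; ring.
Qed.

(** The supremum defining the operator norm is over a set bounded by compactness of
    the unit ball, so it is an upper bound of that set. *)
Lemma enorm_opnorm (R : realType) N (A : 'M[R]_N) (M : R) x :
  opnorm A <= M -> enorm (A *m x) <= M * enorm x.
Proof.
move=> AM; have [x0|x0] := eqVneq x 0.
  by rewrite x0 mulmx0 /enorm -/(nsq _) nsq0 sqrtr0 mulr0.
have e0 : 0 < enorm x.
  rewrite lt_neqAle enorm_ge0 andbT; apply: contra x0 => /eqP h.
  by apply/eqP/nsq_eq0; rewrite -enorm_sqr -h expr0n.
suff h : enorm (A *m ((enorm x)^-1 *: x)) <= M.
  move: h; rewrite -scalemxAr enormZ gtr0_norm ?invr_gt0 //.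
  by rewrite mulrC ler_pdivrMr.
apply: le_trans AM; apply: ub_le_sup; last first.
  exists ((enorm x)^-1 *: x) => //=.
  by rewrite enormZ gtr0_norm ?invr_gt0 // mulVf // lt0r_neq0.
pose D := [set z : 'cV[R]_N | nsq (z - 0) <= 1].
have [c _ cmax] : exists2 c, c \in D & forall z, z \in D ->
    enorm (A *m z) <= enorm (A *m c).
  apply: compact_EVT_max.
  - by exists 0; rewrite /D /= subr0 nsq0.
  - exact: compact_ball.
  - apply: continuous_subspaceT; apply: continuous_enorm.
    by apply: continuous_mulmx; [exact: cont_cst|exact: cont_id].
exists (enorm (A *m c)) => _ [z /= z1 <-]; apply: cmax.
by apply/mem_set; rewrite /D /= subr0 -[1](expr1n _ 2) -enorm_le.
Qed.

(** * Coordinates moving with the drift *)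

Lemma is_derive_line (R : realType) (V : normedModType R) (f : V -> R)
    (z v : V) (s : R) : derivable f (z + s *: v) v ->
  is_derive s (1 : R) (fun s => f (z + s *: v)) ('D_v f (z + s *: v)).
Proof.
have E : (fun h : R => h^-1 *: (((fun s => f (z + s *: v)) \o shift s)
     (h *: (1 : R)) - f (z + s *: v))) =
   (fun h : R => h^-1 *: ((f \o shift (z + s *: v)) (h *: v)
     - f (z + s *: v))).
  apply/funext => h /=; rewrite [_%:A]mulr1 scalerDl addrCA.
  by rewrite [h *: v + _]addrCA.
by move=> df; split; rewrite /derivable /derive E.
Qed.

Lemma is_derive_path (R : realType) (V : normedModType R) (f : V -> R)
    (g : R -> V) (t : R) (dg : V) : differentiable f (g t) ->
  is_derive t (1 : R) g dg -> is_derive t (1 : R) (fun s => f (g s)) ('D_dg f (g t)).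
Proof.
move=> df [/derivable1_diffP dg1 dgE].
have dfg : differentiable (f \o g) t by exact: differentiable_comp.
split; first exact/derivable1_diffP.
by rewrite !deriveE // diff_comp //= -dgE deriveE.
Qed.

Lemma is_derive_pair (R : realType) (V W : normedModType R) (f : R -> V)
    (g : R -> W) (t : R) (df : V) (dg : W) :
  is_derive t (1 : R) f df -> is_derive t (1 : R) g dg ->
  is_derive t (1 : R) (fun s => (f s, g s)) (df, dg).
Proof.
move=> [/derivable1_diffP f1 fE] [/derivable1_diffP g1 gE].
have d : differentiable (fun s => (f s, g s)) t by exact: differentiable_pair.
split; first exact/derivable1_diffP.
by rewrite deriveE // diff_pair //= -!deriveE // fE gE.
Qed.

Lemma is_derive_mx (R : realType) m n (f : R -> 'M[R]_(m, n)) (t : R)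
    (d : 'M[R]_(m, n)) :
  (forall i j, is_derive t (1 : R) (fun s => f s i j) (d i j)) ->
  is_derive t (1 : R) f d.
Proof.
move=> h; have df : derivable f t 1.
  by apply/derivable_mxP => i j; have [] := h i j.
split => //; rewrite derive_mx //; apply/matrixP => i j; rewrite mxE.
by have [] := h i j.
Qed.

Lemma derive_linear (R : realType) (V : normedModType R) (f : V -> R)
    (z v w : V) (a : R) : differentiable f z ->
  'D_(v + a *: w) f z = 'D_v f z + a * 'D_w f z.
Proof.
by move=> df; rewrite !deriveE // linearD linearZ.
Qed.

Lemma derive2_linear (R : realType) (V : normedModType R) (f : V -> R)
    (z a v w : V) (c : R) : (forall z, differentiable f z) ->
  (forall v z, differentiable ('D_v f) z) ->
  'D_a ('D_(v + c *: w) f) z = 'D_a ('D_v f) z + c * 'D_a ('D_w f) z.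
Proof.
move=> df ddf.
have E : 'D_(v + c *: w) f = 'D_v f + c \*: 'D_w f.
  by apply/funext => y; rewrite derive_linear.
rewrite E deriveD; first by rewrite deriveZ //; exact: diff_derivable.
  exact: diff_derivable.
by apply: derivableZ; exact: diff_derivable.
Qed.

Lemma has_d2_line (R : realType) (V : normedModType R) (f : V -> R)
    (z v : V) : (forall z, differentiable f z) ->
  (forall v z, differentiable ('D_v f) z) ->
  has_d2 (fun s => f (z + s *: v)) ('D_v ('D_v f) z).
Proof.
move=> df ddf; exists (fun s => 'D_v f (z + s *: v)).
  by move=> s; apply: is_derive_line; exact: diff_derivable.
have dl : derivable ('D_v f) (z + 0 *: v) v by exact: diff_derivable.
by have := is_derive_line dl; rewrite scale0r addr0.
Qed.

Lemma derive_fst (R : realType) (V : normedModType R) (f : V * R -> R)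
    (v x : V) (t : R) :
  'D_v (fun y => f (y, t)) x = 'D_(v, 0) f (x, t).
Proof.
have E : (fun h : R => h^-1 *: (((fun y => f (y, t)) \o shift x) (h *: v)
     - f (x, t))) =
   (fun h : R => h^-1 *: ((f \o shift (x, t)) (h *: (v, 0)) - f (x, t))).
  apply/funext => h /=; congr (_ *: (f _ - _)).
  by congr pair; rewrite /= scaler0 add0r.
by rewrite /derive E.
Qed.

Lemma derive_snd (R : realType) (V : normedModType R) (f : V * R -> R)
    (x : V) (t : R) :
  derive1 (fun s => f (x, s)) t = 'D_(0, 1) f (x, t).
Proof.
have E : (fun h : R => h^-1 *: (((fun s => f (x, s)) \o shift t) (h *: (1 : R))
     - f (x, t))) =
   (fun h : R => h^-1 *: ((f \o shift (x, t)) (h *: (0, 1)) - f (x, t))).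
  apply/funext => h /=; congr (_ *: (f _ - _)).
  by congr pair; rewrite /= scaler0 add0r.
by rewrite derive1E /derive E.
Qed.

(** Drift and time derivative combine into one directional derivative, along the
    characteristic with velocity (-Bx, 1). *)
Lemma LopE (R : realType) N (B : 'M[R]_N) (u : 'cV[R]_N * R -> R) x t :
  differentiable u (x, t) ->
  Lop B u (x, t) =
    \sum_(i < N) 'D_(delta_mx i 0, 0) ('D_(delta_mx i 0, 0) u) (x, t)
    - 'D_(- (B *m x), 1) u (x, t).
Proof.
move=> du; rewrite /Lop /= derive_snd.
have -> : laplacian (fun y => u (y, t)) x =
    \sum_(i < N) 'D_(delta_mx i 0, 0) ('D_(delta_mx i 0, 0) u) (x, t).
  apply: eq_bigr => i _.
  have E : pderiv i (fun y => u (y, t)) =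
      (fun y => 'D_(delta_mx i 0, 0) u (y, t)).
    by apply/funext => y; exact: derive_fst.
  by rewrite E /pderiv (derive_fst ('D_(delta_mx i 0, 0) u)).
have -> : dotp (B *m x) (grad (fun y => u (y, t)) x) = 'D_(B *m x, 0) u (x, t).
  transitivity (\sum_(i < N) (B *m x) i 0 * 'D_(delta_mx i 0, 0) u (x, t)).
    by apply: eq_bigr => i _; rewrite [grad _ _ _ _]mxE /pderiv derive_fst.
  have {2}-> : B *m x = \sum_(i < N) (B *m x) i 0 *: delta_mx i 0.
    by rewrite [LHS]matrix_sum_delta; apply: eq_bigr => i _; rewrite big_ord1.
  elim/big_rec2 : _ => [|i a b _ ->]; first by rewrite derive0.
  have -> : ((B *m x) i 0 *: delta_mx i 0 + a, 0) =
    (a, 0) + (B *m x) i 0 *: (delta_mx i 0, 0) :> 'cV[R]_N * R.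
    by congr pair; rewrite /= ?scaler0 ?addr0 // addrC.
  by rewrite derive_linear // addrC.
have -> : (- (B *m x), 1) = (0, 1) + (-1) *: (B *m x, 0) :> 'cV[R]_N * R.
  by congr pair; rewrite /= scaleN1r ?oppr0 ?add0r ?addr0.
by rewrite derive_linear //; ring.
Qed.

(** The curves s |-> (exp(-sB) y, s) are the characteristics of the first-order part,
    so along them the time derivative of u is its Laplacian; in the coordinate y the
    Laplacian becomes the sum of second derivatives along the columns of exp(tB). *)
Lemma solution_of_Lop (R : realType) N (B : 'M[R]_N) (u : 'cV[R]_N * R -> R)
    (m : R) : smooth u -> (forall z, Lop B u z = 0) ->
  solution (fun t => expmx (t *: B))
    (fun y t => u (expmx (- t *: B) *m y, t) - m).
Proof.
move=> us uL.
have du z : differentiable u z by have [+ _] := us 1%N; apply.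
have ddu v z : differentiable ('D_v u) z.
  by have [_ /(_ v) [+ _]] := us 2%N; apply.
pose Et (t : R) := expmx (- t *: B).
have dE (t : R) i j : is_derive t (1 : R) (fun t => Et t i j)
    (- (B *m Et t) i j) by exact: is_derive_expmxN.
split.
  have cE : continuous Et.
    apply: continuous_mx => i j t; apply: differentiable_continuous.
    by apply/derivable1_diffP; have [] := dE t i j.
  apply: contB; last exact: cont_cst.
  move=> z; apply: (@continuous_comp _ _ _
    (fun z : 'cV[R]_N * R => (Et z.2 *m z.1, z.2)) u); last first.
    exact: differentiable_continuous.
  move: z; apply: cont_pair; last by apply: cont_snd; exact: cont_id.
  apply: continuous_mulmx; last by apply: cont_fst; exact: cont_id.
  move=> z; apply: (@continuous_comp _ _ _ (fun z : 'cV[R]_N * R => z.2) Et).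
    exact: cvg_snd.
  exact: cE.
move=> y t; pose z := (Et t *m y, t).
pose h (a b : 'cV[R]_N) := 'D_(a, 0) ('D_(b, 0) u) z.
have pairD (a b : 'cV[R]_N) (c : R) :
    (a + c *: b, 0) = (a, 0) + c *: (b, 0) :> 'cV[R]_N * R.
  by congr pair; rewrite /= scaler0 addr0.
have hl c a a' b : h (a + c *: a') b = h a b + c * h a' b.
  by rewrite /h pairD derive_linear.
have hr c a b b' : h a (b + c *: b') = h a b + c * h a b'.
  by rewrite /h pairD derive2_linear.
exists (\sum_(i < N) h (delta_mx i 0) (delta_mx i 0)).
exists (fun a => h (Et t *m a) (Et t *m a)); split.
- have dy : is_derive t (1 : R) (fun s => Et s *m y) (- (B *m (Et t *m y))).
    apply: is_derive_mx => i j.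
    have hd := is_derive_sum (fun l => is_deriveM (dE t i l)
      (is_derive_cst (y l j) t 1)).
    apply: is_derive_ext hd => [s|]; first by rewrite fct_sumE mxE.
    rewrite mulmxA mxE [in RHS]mxE -sumrN; apply: eq_bigr => l _.
    by rewrite /GRing.scale /=; ring.
  have hp := is_derive_path (du z) (is_derive_pair dy (is_derive_id t 1)).
  apply: is_derive_ext (is_deriveB hp (is_derive_cst m t 1)) => [s|] //.
  rewrite subr0; have := uL z; rewrite LopE //.
  by move/eqP; rewrite subr_eq0 => /eqP ->.
- move=> a; pose v : 'cV[R]_N * R := (Et t *m a, 0).
  have hd : has_d2 (fun s => u (z + s *: v)) (h (Et t *m a) (Et t *m a)).
    exact: has_d2_line.
  have hc := has_d2_quadratic (- m) 0 0.
  apply: has_d2_ext (has_d2D hd hc) => [s|]; last by rewrite mulr0 addr0.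
  rewrite !mul0r !addr0; congr (u _ - _); congr pair => /=.
    by rewrite mulmxDr -scalemxAr.
  by rewrite scaler0 addr0.
- move=> n hn; clearbody h.
  apply: etrans (esym (sum_bilinear_refl hl hr hn)) _; apply: eq_bigr => i _.
  have -> : Et t *m (expmx (t *: B) *m refl n i) = refl n i; last by [].
  by have := expmxK B (- t); rewrite opprK mulmxA => ->; rewrite mul1mx.
Qed.

(** The hypothesis bounds exp(tB) for both signs of t, hence also the inverse. *)
Lemma elliptic_expmx (R : realType) N (B : 'M[R]_N) (M : R) :
  (forall t, opnorm (expmx (- t *: B)) <= M) ->
  elliptic (M ^+ 2) (fun t => expmx (t *: B)).
Proof.
move=> hM.
have hE t x : nsq (expmx (t *: B) *m x) <= M ^+ 2 * nsq x.
  have := hM (- t); rewrite opprK => /(enorm_opnorm x) h.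
  rewrite -!enorm_sqr -exprMn lerXn2r ?nnegrE ?enorm_ge0 //.
  exact: le_trans (enorm_ge0 _) h.
move=> t; split => // x; exists (expmx (- t *: B) *m x) => //.
by rewrite mulmxA expmxK mul1mx.
Qed.

Lemma opnorm_bound (R : realType) N (B : 'M[R]_N) :
  (ereal_sup (range (fun t : R => (opnorm (expmx (- t *: B)))%:E)) < +oo)%E ->
  exists2 M : R, 0 < M & forall t, opnorm (expmx (- t *: B)) <= M.
Proof.
set s := ereal_sup _ => s_lty.
have hs t : ((opnorm (expmx (- t *: B)))%:E <= s)%E.
  by apply: ereal_sup_ubound; exists t.
case: s s_lty hs => [r| |] // _ hs; last by have := hs 0; rewrite leeNy_eq.
exists (`|r| + 1) => [|t]; first by rewrite ltr_wpDl.
have := hs t; rewrite lee_fin => /le_trans; apply.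
by apply: le_trans (ler_norm _) _; rewrite lerDl.
Qed.

(** * Convergence to the infimum *)

Theorem theorem1p2 (R : realType) (N : nat) (B : 'M[R]_N)
    (hB : (ereal_sup (range (fun t : R => (opnorm (expmx (- t *: B)))%:E)) < +oo)%E)
    (u : 'cV[R]_N * R -> R)
    (u_smooth : smooth u)
    (u_sol : forall z : 'cV[R]_N * R, Lop B u z = 0)
    (u_bnd : (-oo < ereal_inf (range (fun z : 'cV[R]_N * R => (u z)%:E)))%E) :
  forall x : 'cV[R]_N,
    (u (x, t))%:E @[t --> -oo] -->
    ereal_inf (range (fun z : 'cV[R]_N * R => (u z)%:E)).
Proof.
move=> x; set I := ereal_inf _ in u_bnd *.
have Ile z : (I <= (u z)%:E)%E by apply: ereal_inf_lbound; exists z.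
have Ifin : I \is a fin_num.
  by rewrite fin_numElt u_bnd (le_lt_trans (Ile (0, 0))) ?ltry.
pose m := fine I; have mE : I = m%:E by rewrite fineK.
have mle z : m <= u z by rewrite -lee_fin -mE.
have [M M0 hM] := opnorm_bound hB.
have M20 : 0 < M ^+ 2 by rewrite exprn_gt0.
have [C [kappa [C0 kappa0 har]]] := harnack M20 (elliptic_expmx hM).
pose w y t := u (expmx (- t *: B) *m y, t) - m.
have wsol := solution_of_Lop m u_smooth u_sol.
have w0 y t : 0 <= w y t by rewrite subr_ge0.
have wE t z : w (expmx (t *: B) *m z) t = u (z, t) - m.
  rewrite /w mulmxA; have := expmxK B (- t); rewrite opprK => ->.
  by rewrite mul1mx.
rewrite mE; apply: cvg_EFin; first by near=> t.
apply/cvgrPdist_le => /= e e0.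
have [_ [[x0 t0] _ <-] hx0] :
    exists2 y, range (fun z => (u z)%:E) y & (y < I + (e / C)%:E)%E.
  by apply: lb_ereal_inf_adherent => //; rewrite divr_gt0.
rewrite mE -EFinD lte_fin in hx0.
(* Before time t0 - T the parabolic distance condition of harnack holds for
   every point exp(tB) x at once, as these points stay in a fixed ball. *)
pose T := kappa * (2 * (M ^+ 2 * nsq x0) + 2 * (M ^+ 2 * nsq x)) + 1.
have T0 : 0 < T.
  by rewrite ltr_wpDl // !(mulr_ge0, addr_ge0, nsq_ge0) // ltW.
near=> t.
have tT : t <= t0 - T by near: t; apply: nbhs_ninfty_le; rewrite num_real.
rewrite distrC ger0_norm ?subr_ge0 // -wE.
apply: (@le_trans _ _ (C * w (expmx (t0 *: B) *m x0) t0)).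
  apply: har => //; first by lra.
  have [el _] := elliptic_expmx hM t; have [el0 _] := elliptic_expmx hM t0.
  have h1 := nsqD_le (expmx (t0 *: B) *m x0) (- (expmx (t *: B) *m x)).
  rewrite nsqN in h1.
  have h2 := el x; have h3 := el0 x0.
  suff : nsq (expmx (t0 *: B) *m x0 - expmx (t *: B) *m x) <=
      2 * (M ^+ 2 * nsq x0) + 2 * (M ^+ 2 * nsq x).
    rewrite -(ler_pM2l kappa0); move: tT; rewrite /T; lra.
  lra.
by rewrite wE mulrC -ler_pdivlMr //; lra.
Unshelve. all: by end_near. Qed.
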